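(* Let $f:M\to\mathbb{R}^3$ be a CMC surface ($H=1$, not a round sphere) with Gauss map $N$ and let $d^S_\lambda$ be its associated family given by the conformal Gauss map $S$. Let $\mu\in\mathbb{C}\setminus\{0,\pm1\}$, let $\alpha$ be a non-trivial $d^N_\mu$-parallel section, $\beta=\frac12(N\alpha(a-1)+\alpha b)$ with $a=\frac{\mu+\mu^{-1}}2$, $b=i\frac{\mu^{-1}-\mu}2$, and let $\check f=r^S_{W,\mu}(f)$ be the simple factor dressing given by the complex rank 2 bundle $W\subset\tilde M\times\mathbb{H}^2$ which is spanned by the $d^S_\mu$-parallel sections $en$ and $\varphi=e\alpha+\psi\beta$, $n\in\mathbb{H}\setminus\{0\}$. Then $\check f$ is, up to translation, the simple factor dressing $$r^S_{W,\mu}(f)=r^N_{E,\mu}(f),$$ where $E=\alpha\mathbb{C}$ is the $d^N_\mu$-stable bundle given by $\alpha$. Moreover, up to translation, $\check f$ is a $\mu$-Darboux transform of the parallel surface $g=f+N$, $$\check f=D^{-N}_{\beta,\mu}(g),$$ or, equivalently, the 2-fold Darboux transform given by Bianchi permutability from the Darboux transforms $f^\mu=D^N_{\alpha,\mu}(f)=f+\alpha\beta^{-1}$ and $g=f+N$ of $f$.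
   Context: $\mathbb{H}=\mathrm{span}_{\mathbb{R}}\{1,i,j,k\}=\mathbb{R}^4$, $\mathbb{R}^3=\mathrm{Im}\,\mathbb{H}$, $S^2=\{n\in \mathrm{Im}\,\mathbb{H}: n^2=-1\}$, $\mathbb{C}=\mathrm{span}_{\mathbb{R}}\{1,i\}$ acting by right multiplication. $M$ is a Riemann surface with universal cover $\tilde M$; $*\omega(X)=\omega(JX)$; $e=\begin{pmatrix}1\\0\end{pmatrix}$, $\psi=\begin{pmatrix}f\\1\end{pmatrix}$, $L=\psi\mathbb{H}$ (also over $\tilde M$). CMC surface: conformal immersion with Gauss map $N$ ($*df=N\,df=-df\,N$), normalized to mean curvature $1$, $df=-\frac12(dN-N*dN)$. CMC family: $d^N_\lambda\alpha=d\alpha+\frac12 df(N\alpha(a_\lambda-1)+\alpha b_\lambda)$, $a_\lambda=\frac{\lambda+\lambda^{-1}}2$, $b_\lambda=i\frac{\lambda^{-1}-\lambda}2$. The parallel surface $g=f+N$ has Gauss map $-N$ and family $d^{-N}_\lambda\beta=d\beta+\frac12 dg(-N\beta(a_\lambda-1)+\beta b_\lambda)$. $\mu$-Darboux transforms: $D^N_{\alpha,\mu}(f)=f+\alpha\beta^{-1}$ for a non-trivial $d^N_\mu$-parallel $\alpha$ and $\beta=\frac12(N\alpha(a_\mu-1)+\alpha b_\mu)$; likewise $D^{-N}_{\beta,\mu}(g)=g+\beta\beta_g^{-1}$ for a non-trivial $d^{-N}_\mu$-parallel $\beta$ and $\beta_g=\frac12(-N\beta(a_\mu-1)+\beta b_\mu)$.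 The surface $g$ is itself the $\mu_0$-Darboux transform of $f$ for $\mu_0=-1$ (with $\alpha_0$ any $d^N_{-1}$-parallel section, $\beta_0=-N\alpha_0$). Bianchi permutability: for $\varphi_l=e\alpha_l+\psi\beta_l$ with $d\varphi_l\in\Omega^1(L)$ defining Darboux transforms $f_l=f+\alpha_l\beta_l^{-1}$, $l=1,2$, and $d\varphi_2=d\varphi_1\chi$, the common Darboux transform of $f_1,f_2$ is the surface with line bundle $(\varphi_2-\varphi_1\chi)\mathbb{H}$. CMC simple factor dressing: for $E=\alpha\mathbb{C}$, $r_\lambda=\pi_E\gamma_\lambda+\pi_{Ej}$ along $\tilde M\times\mathbb{C}^2=E\oplus Ej$, $\gamma_\lambda=\frac{1-\bar\mu^{-1}}{1-\mu}\frac{\lambda-\mu}{\lambda-\bar\mu^{-1}}$, the gauged family $r_\lambda\circ d^N_\lambda\circ r_\lambda^{-1}$ is the associated family of the harmonic map $\check N=TNT^{-1}:\tilde M\to S^2$, $T=\alpha\beta^{-1}$, and $r^N_{E,\mu}(f)$ is the CMC surface in $\mathbb{R}^3$ (mean curvature $1$, unique up to translation) with Gauss map $\check N$. Constrained Willmore family and simple factor dressing: $S=F\begin{pmatrix}N&0\\1&-N\end{pmatrix}F^{-1}$, $F=\begin{pmatrix}1&f\\0&1\end{pmatrix}$, $d^S_\lambda(e\nu+\psi\beta)=d(e\nu+\psi\beta)+\frac12\psi\,dg(-N\beta(a_\lambda-1)+\beta b_\lambda)$. For a complex rank 2 bundle $W$ spanned by $d^S_\mu$-parallel sections $\varphi_1,\varphi_2$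 with $\Phi=(\varphi_1,\varphi_2)$ invertible, $r^S_{W,\mu}(f)$ is the surface with line bundle $\check L=\frac12\big(S+\Phi\,\frac{b}{a-1}\,\Phi^{-1}\big)L$, where $\frac{b}{a-1}$ denotes the matrix $\mathrm{diag}\big(\frac{b}{a-1},\frac{b}{a-1}\big)$. *)

(* Defs.v *)
From HB Require Import structures.
From mathcomp Require Import all_boot all_order all_algebra.
From mathcomp Require Import complex ring lra.
From mathcomp Require Import all_classical all_reals all_analysis.

Set Implicit Arguments.
Unset Strict Implicit.
Unset Printing Implicit Defensive.

Import Order.TTheory GRing.Theory Num.Theory numFieldNormedType.Exports.
Local Open Scope classical_set_scope.
Local Open Scope ring_scope.

Record quat (R : Type) := Quat { qre : R; qi : R; qj : R; qk : R }.

Definition prod_of_quat (R : Type) (x : quat R) :=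
  (qre x, qi x, qj x, qk x).
Definition quat_of_prod (R : Type) (t : R * R * R * R) :=
  let: (a, b, c, d) := t in Quat a b c d.
Lemma prod_of_quatK (R : Type) :
  cancel (@prod_of_quat R) (@quat_of_prod R).
Proof. by case. Qed.

HB.instance Definition _ (R : eqType) :=
  Equality.copy (quat R) (can_type (@prod_of_quatK R)).
HB.instance Definition _ (R : choiceType) :=
  Choice.copy (quat R) (can_type (@prod_of_quatK R)).

Section QuatRing.
Variable R : realFieldType.
Implicit Types x y z : quat R.

Definition addq x y :=
  Quat (qre x + qre y) (qi x + qi y) (qj x + qj y) (qk x + qk y).
Definition oppq x := Quat (- qre x) (- qi x) (- qj x) (- qk x).
Definition mulq x y :=
  Quat (qre x * qre y - qi x * qi y - qj x * qj y - qk x * qk y)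
       (qre x * qi y + qi x * qre y + qj x * qk y - qk x * qj y)
       (qre x * qj y - qi x * qk y + qj x * qre y + qk x * qi y)
       (qre x * qk y + qi x * qj y - qj x * qi y + qk x * qre y).
Definition zeroq : quat R := Quat 0 0 0 0.
Definition oneq : quat R := Quat 1 0 0 0.
Definition sqnormq x := qre x ^+ 2 + qi x ^+ 2 + qj x ^+ 2 + qk x ^+ 2.
Definition invq x :=
  Quat (qre x / sqnormq x) (- qi x / sqnormq x)
       (- qj x / sqnormq x) (- qk x / sqnormq x).

Fact addqA : associative addq.
Proof. by move=> x y z; rewrite /addq /= !addrA. Qed.
Fact addqC : commutative addq.
Proof. by move=> x y; congr Quat; rewrite addrC. Qed.
Fact add0q : left_id zeroq addq.
Proof. by case=> a b c d; rewrite /addq /= !add0r. Qed.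
Fact addNq : left_inverse zeroq oppq addq.
Proof. by case=> a b c d; rewrite /addq /= !addNr. Qed.

HB.instance Definition _ :=
  GRing.isZmodule.Build (quat R) addqA addqC add0q addNq.

Fact mulqA : associative mulq.
Proof. by move=> x y z; rewrite /mulq /=; congr Quat; ring. Qed.
Fact mul1q : left_id oneq mulq.
Proof. by case=> a b c d; rewrite /mulq /=; congr Quat; ring. Qed.
Fact mulq1 : right_id oneq mulq.
Proof. by case=> a b c d; rewrite /mulq /=; congr Quat; ring. Qed.
Fact mulqDl : left_distributive mulq addq.
Proof. by move=> x y z; rewrite /mulq /addq /=; congr Quat; ring. Qed.
Fact mulqDr : right_distributive mulq addq.
Proof. by move=> x y z; rewrite /mulq /addq /=; congr Quat; ring. Qed.
Fact oneq_neq0 : oneq != zeroq.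
Proof. by apply/eqP => -[/eqP]; rewrite oner_eq0. Qed.

HB.instance Definition _ := GRing.Zmodule_isNzRing.Build (quat R)
  mulqA mul1q mulq1 mulqDl mulqDr oneq_neq0.

Lemma sqnormq_eq0 x : (sqnormq x == 0) = (x == 0).
Proof.
apply/eqP/eqP => [|->]; last by rewrite /sqnormq /= !expr0n /= !addr0.
case: x => a b c d; rewrite /sqnormq /= => h.
have [ha hb hc hd] := And4 (sqr_ge0 a) (sqr_ge0 b) (sqr_ge0 c) (sqr_ge0 d).
have z (t : R) : t ^+ 2 = 0 -> t = 0 by move=> /eqP; rewrite sqrf_eq0 => /eqP.
have -> : a = 0 by apply: z; lra.
have -> : b = 0 by apply: z; lra.
have -> : c = 0 by apply: z; lra.
have -> : d = 0 by apply: z; lra.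
by [].
Qed.

Definition unitq : pred (quat R) := fun x => x != 0.
Definition invq0 x := if x == 0 then x else invq x.

Fact mulVq : {in unitq, left_inverse 1 invq0 *%R}.
Proof.
move=> x; rewrite /in_mem /= /unitq => x0.
rewrite /invq0 (negbTE x0); move: x0; rewrite -sqnormq_eq0.
case: x => a b c d h; rewrite -[LHS]/(mulq _ _) /mulq /invq /=.
by congr Quat; rewrite /sqnormq /= in h *; field.
Qed.
Fact mulqV : {in unitq, right_inverse 1 invq0 *%R}.
Proof.
move=> x; rewrite /in_mem /= /unitq => x0.
rewrite /invq0 (negbTE x0); move: x0; rewrite -sqnormq_eq0.
case: x => a b c d h; rewrite -[LHS]/(mulq _ _) /mulq /invq /=.
by congr Quat; rewrite /sqnormq /= in h *; field.
Qed.
Fact unitqP x y : y * x = 1 /\ x * y = 1 -> unitq x.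
Proof.
move=> [h _]; apply/eqP => x0; move: h; rewrite x0 mulr0 => /eqP.
by rewrite eq_sym oner_eq0.
Qed.
Fact invq_out : {in [predC unitq], invq0 =1 id}.
Proof. by move=> x; rewrite inE /= /in_mem /= /unitq negbK /invq0 => ->. Qed.

HB.instance Definition _ := GRing.NzRing_hasMulInverse.Build (quat R)
  mulVq mulqV unitqP invq_out.

(* The embedding of C as span_R {1, i}. *)
Definition qC (z : complex R) : quat R := Quat (complex.Re z) (complex.Im z) 0 0.

Definition imq : set (quat R) := [set x | qre x = 0].

Definition sphere2 : set (quat R) := [set x | imq x /\ x * x = - 1].

End QuatRing.

Arguments imq {R}.
Arguments sphere2 {R}.

Section Plane.
Variable R : realType.
Local Notation plane := (R * R)%type.

Definition Jplane (v : plane) : plane := (- v.2, v.1).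

(* C-infinity on the open set D: all iterated directional derivatives of every
   order (the order-zero one being F itself) are differentiable on D. *)
Definition smooth_on (D : set plane) (F : plane -> R) :=
  forall (s : seq plane) z, D z ->
    differentiable (foldr (fun v G => 'D_v G) F s : plane -> R) z.

(* Holomorphic functions are required to be C-infinity, which by Goursat's
   theorem is no restriction, with a differential that is complex linear. *)
Definition holomorphic_on (D : set plane) (h : plane -> plane) :=
  [/\ smooth_on D (fst \o h), smooth_on D (snd \o h) &
      forall z v, D z -> 'd h z (Jplane v) = Jplane ('d h z v)].

End Plane.

(* A connected Hausdorff space with an atlas.  The chart with index i is the
   homeomorphism [rs_chart i] from the open set [rs_dom i] onto the open set
   [rs_chart i @` rs_dom i], with inverse [rs_inv i]; the values of these total
   functions outside these sets are irrelevant. *)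
Record riemannSurface (R : realType) := RiemannSurface {
  rs_carrier :> topologicalType;
  rs_idx : Type;
  rs_dom : rs_idx -> set rs_carrier;
  rs_chart : rs_idx -> rs_carrier -> R * R;
  rs_inv : rs_idx -> R * R -> rs_carrier;
  rs_hausdorff : hausdorff_space rs_carrier;
  rs_nonempty : [set: rs_carrier] !=set0;
  rs_connected : connected [set: rs_carrier];
  rs_dom_open : forall i, open (rs_dom i);
  rs_cover : forall p, exists i, rs_dom i p;
  rs_codom_open : forall i, open (rs_chart i @` rs_dom i);
  rs_chartK : forall i p, rs_dom i p -> rs_inv i (rs_chart i p) = p;
  rs_chart_continuous : forall i p, rs_dom i p ->
    {for p, continuous (rs_chart i)};
  rs_inv_continuous : forall i p, rs_dom i p ->
    {for rs_chart i p, continuous (rs_inv i)};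
  rs_transition : forall i j,
    holomorphic_on (rs_chart i @` (rs_dom i `&` rs_dom j))
                   (rs_chart j \o rs_inv i)
}.

Section Surfaces.
Variable R : realType.
Local Notation H := (quat R).
Local Notation C := (complex R).

Definition holomorphic_map (M M' : riemannSurface R) (A : set M) (F : M -> M') :=
  (forall p, A p -> {for p, continuous F}) /\
  forall (i : rs_idx M) (j : rs_idx M'),
    holomorphic_on
      (rs_chart i @` (rs_dom i `&` A `&` (F @^-1` rs_dom j)))
      (rs_chart j \o F \o rs_inv i).

(* Every point of M has an open neighbourhood V that is evenly covered by
   sheets U k, on each of which pi is biholomorphic onto V with inverse
   sigma k. *)
Definition holomorphic_covering (Mt M : riemannSurface R) (pi : Mt -> M) :=
  holomorphic_map setT pi /\
  forall q : M, exists (V : set M) (K : Type) (U : K -> set Mt)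
                       (sigma : K -> M -> Mt),
    [/\ open V /\ V q,
        pi @^-1` V = \bigcup_k U k,
        trivIset setT U &
        forall k, [/\ open (U k),
                      holomorphic_map V (sigma k),
                      forall x, V x -> U k (sigma k x) /\ pi (sigma k x) = x &
                      forall p, U k p -> sigma k (pi p) = p]].

Definition simply_connected (X : topologicalType) :=
  [/\ [set: X] !=set0,
      forall x y : X, exists c : R -> X,
        [/\ {within `[0, 1]%classic, continuous c}, c 0 = x & c 1 = y] &
      forall c : R -> X, {within `[0, 1]%classic, continuous c} -> c 0 = c 1 ->
        exists h : R * R -> X,
          [/\ {within `[0, 1]%classic `*` `[0, 1]%classic, continuous h},
              forall t, `[0, 1]%classic t -> h (0, t) = c t,
              forall t, `[0, 1]%classic t -> h (1, t) = c 0 &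
              forall s, `[0, 1]%classic s -> h (s, 0) = c 0 /\ h (s, 1) = c 0]].

Definition universal_cover (Mt M : riemannSurface R) (pi : Mt -> M) :=
  holomorphic_covering pi /\ simply_connected Mt.

Section Forms.
Variable M : riemannSurface R.

Definition smoothR (u : M -> R) :=
  forall i, smooth_on (rs_chart i @` rs_dom i) (u \o rs_inv i).

Definition smoothH (F : M -> H) :=
  [/\ smoothR (@qre R \o F), smoothR (@qi R \o F),
      smoothR (@qj R \o F) & smoothR (@qk R \o F)].

(* A 1-form is given by its value on the tangent vector at p whose coordinates
   in the chart i are v; it is only meaningful if p is in the domain of i. *)
Definition form (V : Type) := rs_idx M -> M -> R * R -> V.

Definition eq_form (V : Type) (w e : form V) :=
  forall i p v, rs_dom i p -> w i p v = e i p v.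

Definition dR (u : M -> R) : form R :=
  fun i p v => 'D_v (u \o rs_inv i) (rs_chart i p).

Definition dH (F : M -> H) : form H := fun i p v =>
  Quat (dR (@qre R \o F) i p v) (dR (@qi R \o F) i p v)
       (dR (@qj R \o F) i p v) (dR (@qk R \o F) i p v).

Definition star (w : form H) : form H := fun i p v => w i p (Jplane v).

Definition lmulf (F : M -> H) (w : form H) : form H := fun i p v => F p * w i p v.
Definition rmulf (w : form H) (F : M -> H) : form H := fun i p v => w i p v * F p.

Definition immersion (f : M -> H) :=
  forall i p v, rs_dom i p -> v != 0 -> dH f i p v != 0.

(* The last clause says that the mean curvature is 1: in general
   1/2 (dN - N * dN) = - H df. *)
Definition cmc_surface (f N : M -> H) :=
  [/\ smoothH f /\ (forall p, imq (f p)),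
      smoothH N /\ (forall p, sphere2 (N p)),
      immersion f,
      eq_form (star (dH f)) (lmulf N (dH f)) /\
      eq_form (star (dH f)) (fun i p v => - rmulf (dH f) N i p v) &
      eq_form (dH f)
        (fun i p v => - 2^-1 * (dH N i p v - lmulf N (star (dH N)) i p v))].

(* The image of f is contained in a round sphere. *)
Definition round_sphere (f : M -> H) :=
  exists (m : H) (r : R), 0 < r /\ forall p, sqnormq (f p - m) = r ^+ 2.

Definition a_ (lam : C) : C := (lam + lam^-1) / 2.
Definition b_ (lam : C) : C := Complex 0 1 * (lam^-1 - lam) / 2.

Definition beta_of (N : M -> H) (lam : C) (al : M -> H) : M -> H := fun p =>
  2^-1 * (N p * al p * qC (a_ lam - 1) + al p * qC (b_ lam)).

(* The second summand is 1/2 df (N alpha (a - 1) + alpha b).  The family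
   d^{-N}_lambda of the parallel surface g is [dN g (- N)]. *)
Definition dN (f N : M -> H) (lam : C) (al : M -> H) : form H := fun i p v =>
  dH al i p v + dH f i p v * beta_of N lam al p.

Definition parallelN (f N : M -> H) (lam : C) (al : M -> H) :=
  smoothH al /\ eq_form (dN f N lam al) (fun _ _ _ => 0).

Definition nontrivial_parallelN (f N : M -> H) (lam : C) (al : M -> H) :=
  parallelN f N lam al /\ exists p, al p != 0.

Definition darboux_map (f : M -> H) (al be : M -> H) : M -> H :=
  fun p => f p + al p * (be p)^-1.

(* fh = D^N_{alpha, mu}(f) *)
Definition mu_darboux (f N : M -> H) (mu : C) (al : M -> H) (fh : M -> H) :=
  nontrivial_parallelN f N mu al /\
  forall p, beta_of N mu al p != 0 /\
            fh p = darboux_map f al (beta_of N mu al) p.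

Definition translate (h : M -> H) (c : H) : M -> H := fun p => h p + c.

Definition eq_up_to_translation (f h : M -> H) := exists c, f = translate h c.

(* The projections onto E = alpha C and E j along H = E (+) E j. *)
Definition projE (x y : H) : H :=
  let z := x^-1 * y in x * Quat (qre z) (qi z) 0 0.
Definition projEj (x y : H) : H :=
  let z := x^-1 * y in x * Quat 0 0 (qj z) (qk z).

Definition gamma_ (mu lam : C) : C :=
  (1 - (conjc mu)^-1) / (1 - mu) * ((lam - mu) / (lam - (conjc mu)^-1)).

Definition dressing_gauge (mu lam : C) (al s : M -> H) : M -> H := fun p =>
  projE (al p) (s p) * qC (gamma_ mu lam) + projEj (al p) (s p).

Definition dressing_gauge_form (mu lam : C) (al : M -> H) (w : form H) : form H :=
  fun i p v => projE (al p) (w i p v) * qC (gamma_ mu lam) + projEj (al p) (w i p v).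

Definition lineC (al : M -> H) : M -> set H :=
  fun p => [set al p * qC z | z in setT].

(* h is a surface r^N_{E, mu}(f), E being spanned by a nowhere vanishing
   parallel section: a CMC surface with Gauss map T N T^-1, whose family is
   r_lambda o d^N_lambda o r_lambda^-1 (written as an intertwining relation,
   for those lambda for which r_lambda is defined and invertible). *)
Definition sfd_N (f N : M -> H) (mu : C) (E : M -> set H) (h : M -> H) :=
  exists al : M -> H,
    [/\ parallelN f N mu al /\ (forall p, al p != 0),
        E = lineC al &
        let T := fun p => al p * (beta_of N mu al p)^-1 in
        let Nh := fun p => T p * N p * (T p)^-1 in
        cmc_surface h Nh /\
        forall lam : C, lam != 0 -> lam != mu -> lam != (conjc mu)^-1 ->
        forall s : M -> H, smoothH s ->
          eq_form (dN h Nh lam (dressing_gauge mu lam al s))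
                  (dressing_gauge_form mu lam al (dN f N lam s))].

Definition mat2 (a b c d : H) : 'M[H]_2 :=
  \matrix_(k < 2, l < 2)
    if k == 0 then (if l == 0 then a else b) else (if l == 0 then c else d).
Definition col2 (a b : H) : 'cV[H]_2 := \col_(k < 2) if k == 0 then a else b.

(* H^2 is a right vector space, whereas *: is multiplication from the left. *)
Definition rscale (u : 'cV[H]_2) (x : H) : 'cV[H]_2 := \col_k (u k 0 * x).

Definition evec : 'cV[H]_2 := col2 1 0.
Definition psi (x : H) : 'cV[H]_2 := col2 x 1.

Definition lineH (u : 'cV[H]_2) : set 'cV[H]_2 := [set rscale u x | x in setT].

Definition section (f al be : M -> H) : M -> 'cV[H]_2 :=
  fun p => rscale evec (al p) + rscale (psi (f p)) (be p).

Definition smoothH2 (phi : M -> 'cV[H]_2) :=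
  forall k, smoothH (fun p => phi p k 0).

Definition dH2 (phi : M -> 'cV[H]_2) : form 'cV[H]_2 :=
  fun i p v => \col_k dH (fun q => phi q k 0) i p v.

(* The conformal Gauss map S = F (N 0 ; 1 -N) F^-1, where F = (1 f ; 0 1) and
   hence F^-1 = (1 -f ; 0 1). *)
Definition Smap (f N : M -> H) : M -> 'M[H]_2 := fun p =>
  mat2 1 (f p) 0 1 *m mat2 (N p) 0 1 (- N p) *m mat2 1 (- f p) 0 1.

(* The family d^S_lambda.  If phi = e nu + psi beta then beta is the second
   entry of phi. *)
Definition dS (f N : M -> H) (lam : C) (phi : M -> 'cV[H]_2) : form 'cV[H]_2 :=
  let g := fun p => f p + N p in
  let be := fun p => phi p 1 0 in
  fun i p v => dH2 phi i p v +
    rscale (psi (f p)) (dH g i p v * beta_of (fun q => - N q) lam be p).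

Definition parallelS (f N : M -> H) (lam : C) (phi : M -> 'cV[H]_2) :=
  smoothH2 phi /\ eq_form (dS f N lam phi) (fun _ _ _ => 0).

Definition spanC (phi1 phi2 : M -> 'cV[H]_2) : M -> set 'cV[H]_2 := fun p =>
  [set u | exists z1 z2 : C,
     u = rscale (phi1 p) (qC z1) + rscale (phi2 p) (qC z2)].

(* fh is the surface r^S_{W, mu}(f).  Here Psi is the inverse of Phi, for which
   [invmx] is not available over a noncommutative ring. *)
Definition sfd_S (f N : M -> H) (mu : C) (W : M -> set 'cV[H]_2) (fh : M -> H) :=
  exists (phi1 phi2 : M -> 'cV[H]_2) (Psi : M -> 'M[H]_2),
    let Phi := fun p => row_mx (phi1 p) (phi2 p) : 'M[H]_2 in
    let c := qC (b_ mu / (a_ mu - 1)) in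
    [/\ parallelS f N mu phi1 /\ parallelS f N mu phi2,
        W = spanC phi1 phi2,
        forall p, Phi p *m Psi p = 1%:M /\ Psi p *m Phi p = 1%:M &
        forall p, lineH (psi (fh p)) =
          [set 2^-1 *: (Smap f N p + Phi p *m mat2 c 0 0 c *m Psi p) *m u
             | u in lineH (psi (f p))]].

(* fh is the common Darboux transform of f1 and f2 given by the sections
   phi_l = e alpha_l + psi beta_l. *)
Definition bianchi (f al1 be1 al2 be2 f1 f2 fh : M -> H) :=
  let phi1 := section f al1 be1 in
  let phi2 := section f al2 be2 in
  exists chi : M -> H,
    [/\ [/\ smoothH2 phi1, smoothH2 phi2 & smoothH chi],
        (forall i p v, rs_dom i p -> lineH (psi (f p)) (dH2 phi1 i p v) /\
                                     lineH (psi (f p)) (dH2 phi2 i p v)),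
        (forall p, [/\ be1 p != 0, be2 p != 0, f1 p = darboux_map f al1 be1 p &
                       f2 p = darboux_map f al2 be2 p]),
        eq_form (dH2 phi2) (fun i p v => rscale (dH2 phi1 i p v) (chi p)) &
        forall p, lineH (psi (fh p)) = lineH (phi2 p - rscale (phi1 p) (chi p))].

End Forms.
End Surfaces.

(* Main.v *)
(* Put c = b / (a - 1), k = (a - 1) / 2 and chat = alpha c alpha^-1.  From
   a^2 + b^2 = 1 one gets (1 + c^2) k = -1, hence N beta = alpha + beta c and
   beta_g = - alpha k.  Therefore the mu-Darboux transform of g is
   g + beta beta_g^-1 = f - chat, while the formula for the line bundle of
   r^S_{W,mu}(f) evaluates to f - chat + n c n^-1.  With T = alpha beta^-1 the
   dressed Gauss map is T N T^-1 = T + chat, and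
     d(f - chat) = - (N + chat) df T^-1,   d(f + T) = - T dg (alpha k) beta^-1,
   from which f - chat is CMC, up to the constant real part of chat, with Gauss
   map T N T^-1 and parallel surface f + T.  On E + E j the gauge r_lambda is, up
   to a constant complex factor on the right, s |-> s C - chat s, where C is c
   with lambda in place of mu; the gauge relation becomes three identities
   between 1-forms, the coefficients of 1, C and C^2.

   Parallel sections have no zeros: by Gronwall's inequality along segments of
   charts the zero set is open, and it is closed; the same argument shows that a
   CMC surface is determined by its Gauss map up to translation. *)
From HB Require Import structures.
Require Import Defs.
From mathcomp Require Import all_boot all_order all_algebra.
From mathcomp Require Import complex ring lra.
From mathcomp Require Import all_classical all_reals all_analysis.

Set Implicit Arguments.
Unset Strict Implicit.
Unset Printing Implicit Defensive.

Import Order.TTheory GRing.Theory Num.Theory numFieldNormedType.Exports.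
Local Open Scope classical_set_scope.
Local Open Scope ring_scope.

(** * Smooth functions of two real variables *)

(** [f] and [g] have the same first-order expansion at [x]. Chart expressions agree with the
    intended functions only on open sets, which is where this is needed. *)
Lemma near_eq_differentiable (R : numFieldType) (V W : normedModType R)
    (f g : V -> W) (x : V) :
  (\near x, f x = g x) -> differentiable f x -> differentiable g x.
Proof.
move=> fg df; have dfc : continuous ('d f x) by exact: diff_continuous.
have gE : g \o shift x = cst (g x) + 'd f x +o_ (0 : V) id.
  apply/eqaddoP => e e0; have /eqaddoP/(_ e e0) := diff_locally df.
  have fgx : f x = g x by exact: nbhs_singleton fg.
  move: fg; rewrite (near_shift 0) subr0 => fg.
  apply: filterS2 fg => y /= fgy.
  by rewrite /= !fctE /= fgx fgy.
apply/diff_locallyP; rewrite (diff_unique dfc gE); split=> //.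
Qed.

Section PlanarCalculus.
Variable R : realType.
Local Notation plane := (R * R)%type.
Implicit Types (D : set plane) (F G : plane -> R).

Definition iter_derive (s : seq plane) F := foldr (fun v G => 'D_v G) F s.

(** Smoothness truncated at order [n]: closure under products, inverses and composition is proved by
    induction on the order. *)
Definition Cn_on n D F :=
  forall s z, (size s <= n)%N -> D z -> differentiable (iter_derive s F) z.

Lemma smooth_onP D F : smooth_on D F <-> forall n, Cn_on n D F.
Proof.
split=> [sF n s z _|sF s z Dz]; first exact: sF.
exact: (sF (size s) s z (leqnn _)).
Qed.

Lemma Cn_on0 D F : Cn_on 0 D F <-> forall z, D z -> differentiable F z.
Proof.
split=> [cF z Dz|dF [|//] z _ /dF//]; exact: (cF [::]).
Qed.

(** The last entry of a list of directions is the innermost derivative, so lists are split from the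
    right with [rcons]. *)
Lemma Cn_onS n D F :
  Cn_on n.+1 D F <->
  (forall z, D z -> differentiable F z) /\ forall v, Cn_on n D ('D_v F).
Proof.
split=> [cF|[dF cF] s z].
  split=> [z Dz|v s z sn Dz]; first exact: (cF [::]).
  by have := cF (rcons s v) z; rewrite size_rcons ltnS /iter_derive foldr_rcons; exact.
case: (lastP s) => [_ /dF//|s' v].
by rewrite size_rcons ltnS /iter_derive foldr_rcons; exact: cF.
Qed.

Lemma Cn_on_le m n D F : (m <= n)%N -> Cn_on n D F -> Cn_on m D F.
Proof. by move=> mn cF s z sm; apply: cF; apply: leq_trans mn. Qed.

Lemma Cn_on_diff n D F z : Cn_on n D F -> D z -> differentiable F z.
Proof. by move=> cF; exact: (cF [::]). Qed.

Lemma derive_eq_on D F G v : open D -> (forall z, D z -> F z = G z) ->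
  forall z, D z -> 'D_v F z = 'D_v G z.
Proof.
move=> oD FG z Dz; apply: near_eq_derive.
by apply: filterS (open_nbhs_nbhs (conj oD Dz)) => y /FG.
Qed.

Lemma eq_Cn_on n D F G : open D -> (forall z, D z -> F z = G z) ->
  Cn_on n D F -> Cn_on n D G.
Proof.
move=> oD; elim: n F G => [|n IH] F G FG.
  move=> /Cn_on0 dF; apply/Cn_on0 => z Dz; apply: near_eq_differentiable (dF _ Dz).
  by apply: filterS (open_nbhs_nbhs (conj oD Dz)) => y /FG.
move=> /Cn_onS[dF cF]; apply/Cn_onS; split=> [z Dz|v].
  apply: near_eq_differentiable (dF _ Dz).
  by apply: filterS (open_nbhs_nbhs (conj oD Dz)) => y /FG.
exact: IH (derive_eq_on v oD FG) (cF v).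
Qed.

Lemma Cn_on_cst n D (c : R) : Cn_on n D (fun=> c).
Proof.
elim: n c => [|n IH] c; first by apply/Cn_on0 => z _; exact: differentiable_cst.
apply/Cn_onS; split=> [z _|v]; first exact: differentiable_cst.
rewrite (_ : 'D_v _ = fun=> 0); first exact: IH.
by apply/funext => z; rewrite derive_cst.
Qed.

Lemma Cn_onD n D F G : open D -> Cn_on n D F -> Cn_on n D G ->
  Cn_on n D (fun z => F z + G z).
Proof.
move=> oD; elim: n F G => [|n IH] F G.
  move=> /Cn_on0 dF /Cn_on0 dG; apply/Cn_on0 => z Dz.
  by apply: differentiableD; [exact: dF|exact: dG].
move=> /Cn_onS[dF cF] /Cn_onS[dG cG]; apply/Cn_onS; split=> [z Dz|v].
  by apply: differentiableD; [exact: dF|exact: dG].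
apply: eq_Cn_on (IH _ _ (cF v) (cG v)) => // z Dz.
by rewrite deriveD//; apply: diff_derivable; [exact: dF|exact: dG].
Qed.

Lemma Cn_onM n D F G : open D -> Cn_on n D F -> Cn_on n D G ->
  Cn_on n D (fun z => F z * G z).
Proof.
move=> oD; elim: n F G => [|n IH] F G.
  move=> /Cn_on0 dF /Cn_on0 dG; apply/Cn_on0 => z Dz.
  by apply: differentiableM; [exact: dF|exact: dG].
move=> cF1 cG1; have /Cn_onS[dF cF] := cF1; have /Cn_onS[dG cG] := cG1.
apply/Cn_onS; split=> [z Dz|v].
  by apply: differentiableM; [exact: dF|exact: dG].
have cF0 := Cn_on_le (leqnSn n) cF1; have cG0 := Cn_on_le (leqnSn n) cG1.
apply: eq_Cn_on (Cn_onD oD (IH _ _ cF0 (cG v)) (IH _ _ cG0 (cF v))) => // z Dz.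
by rewrite deriveM//; apply: diff_derivable; [exact: dF|exact: dG].
Qed.

Lemma Cn_onV n D F : open D -> (forall z, D z -> F z != 0) ->
  Cn_on n D F -> Cn_on n D (fun z => (F z)^-1).
Proof.
move=> oD F0; elim: n => [|n IH].
  move=> /Cn_on0 dF; apply/Cn_on0 => z Dz.
  by apply: differentiableV; [exact: dF|exact: F0].
move=> cF1; have /Cn_onS[dF cF] := cF1.
have cV := IH (Cn_on_le (leqnSn n) cF1).
apply/Cn_onS; split=> [z Dz|v].
  by apply: differentiableV; [exact: dF|exact: F0].
(* The derivative of [1/F] is [-1] times [(1/F)^2 'D_v F], whose factors are all of order [n]. *)
have cN := Cn_onM oD (@Cn_on_cst n D (-1)) (Cn_onM oD (Cn_onM oD cV cV) (cF v)).
apply: eq_Cn_on cN => // z Dz.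
rewrite deriveV ?F0//; last exact: diff_derivable (dF _ Dz).
by rewrite mulN1r -exprVn expr2 [RHS]mulNr.
Qed.

Lemma linear_planeE (L : {linear plane -> R}) (x y : R) :
  L (x, y) = L (1, 0) * x + L (0, 1) * y.
Proof.
have -> : (x, y) = x *: ((1, 0) : plane) + y *: ((0, 1) : plane).
  by congr pair; rewrite /= /GRing.scale/= !(mulr1, mulr0, addr0, add0r).
by rewrite linearD !linearZ/= /GRing.scale /= mulrC [y * _]mulrC.
Qed.

Lemma derive_comp_plane F (h : plane -> plane) z v :
  differentiable (fst \o h) z -> differentiable (snd \o h) z ->
  differentiable F (h z) ->
  'D_v (F \o h) z = 'D_(1, 0) F (h z) * 'D_v (fst \o h) z +
                    'D_(0, 1) F (h z) * 'D_v (snd \o h) z.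
Proof.
move=> d1 d2 dF.
have hE : h = (fun y => ((fst \o h) y, (snd \o h) y)).
  by apply/funext => y /=; case: (h y).
have dh : differentiable h z by rewrite hE; exact: differentiable_pair.
rewrite deriveE; last exact: differentiable_comp.
rewrite diff_comp//= !deriveE// [in 'd h z]hE diff_pair//=.
exact: linear_planeE.
Qed.

(** By the chain rule a derivative of [F \o h] is a sum of products of ['D_u F \o h] with
    derivatives of the components of [h]; the induction therefore runs over all [F] at once. *)
Lemma Cn_on_comp n D D' F (h : plane -> plane) : open D ->
  (forall z, D z -> D' (h z)) ->
  Cn_on n D (fst \o h) -> Cn_on n D (snd \o h) ->
  Cn_on n D' F -> Cn_on n D (F \o h).
Proof.
move=> oD hD.
have dcomp (G : plane -> R) z : D z -> differentiable (fst \o h) z ->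
    differentiable (snd \o h) z -> differentiable G (h z) ->
    differentiable (G \o h) z.
  move=> Dz d1 d2 dG; apply: differentiable_comp => //.
  rewrite (_ : h = (fun y => ((fst \o h) y, (snd \o h) y))).
    exact: differentiable_pair.
  by apply/funext => y /=; case: (h y).
elim: n F => [|n IH] F c1 c2 cF.
  apply/Cn_on0 => z Dz; apply: dcomp (Cn_on_diff c1 Dz) (Cn_on_diff c2 Dz) _ => //.
  exact: Cn_on_diff cF (hD _ Dz).
have /Cn_onS[d1 D1] := c1; have /Cn_onS[d2 D2] := c2; have /Cn_onS[dF cF'] := cF.
apply/Cn_onS; split=> [z Dz|v].
  by apply: dcomp => //; [exact: d1|exact: d2|exact/dF/hD].
have IH' u := IH ('D_u F) (Cn_on_le (leqnSn n) c1) (Cn_on_le (leqnSn n) c2) (cF' u).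
apply: eq_Cn_on (Cn_onD oD (Cn_onM oD (IH' (1, 0)) (D1 v))
  (Cn_onM oD (IH' (0, 1)) (D2 v))) => // z Dz.
by rewrite [RHS](derive_comp_plane v (d1 z Dz) (d2 z Dz) (dF _ (hD z Dz))).
Qed.

Lemma smooth_on_diff D F z : smooth_on D F -> D z -> differentiable F z.
Proof. by move=> sF; exact: (sF [::]). Qed.

Lemma smooth_on_derive D F v : smooth_on D F -> smooth_on D ('D_v F).
Proof. by move=> sF s z Dz; have := sF (rcons s v) z Dz; rewrite foldr_rcons. Qed.

Lemma smooth_on_local D F :
  (forall z, D z -> exists2 D', D' z & smooth_on D' F) -> smooth_on D F.
Proof. by move=> locF s z /locF[D' D'z sF]; exact: sF. Qed.

Lemma eq_smooth_on D F G : open D -> (forall z, D z -> F z = G z) ->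
  smooth_on D F -> smooth_on D G.
Proof. by move=> oD FG /smooth_onP sF; apply/smooth_onP => n; apply: eq_Cn_on FG _. Qed.

Lemma smooth_on_cst D (c : R) : smooth_on D (fun=> c).
Proof. by apply/smooth_onP => n; exact: Cn_on_cst. Qed.

Lemma smooth_onD D F G : open D -> smooth_on D F -> smooth_on D G ->
  smooth_on D (fun z => F z + G z).
Proof. by move=> oD /smooth_onP sF /smooth_onP sG; apply/smooth_onP => n; exact: Cn_onD. Qed.

Lemma smooth_onM D F G : open D -> smooth_on D F -> smooth_on D G ->
  smooth_on D (fun z => F z * G z).
Proof. by move=> oD /smooth_onP sF /smooth_onP sG; apply/smooth_onP => n; exact: Cn_onM. Qed.

Lemma smooth_onV D F : open D -> (forall z, D z -> F z != 0) ->
  smooth_on D F -> smooth_on D (fun z => (F z)^-1).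
Proof. by move=> oD F0 /smooth_onP sF; apply/smooth_onP => n; exact: Cn_onV. Qed.

Lemma smooth_on_comp D D' F (h : plane -> plane) : open D ->
  (forall z, D z -> D' (h z)) ->
  smooth_on D (fst \o h) -> smooth_on D (snd \o h) ->
  smooth_on D' F -> smooth_on D (F \o h).
Proof.
move=> oD hD /smooth_onP s1 /smooth_onP s2 /smooth_onP sF; apply/smooth_onP => n.
exact: Cn_on_comp hD (s1 n) (s2 n) (sF n).
Qed.

Lemma holomorphic_on_diff D (h : plane -> plane) z :
  holomorphic_on D h -> D z -> differentiable h z.
Proof.
move=> [s1 s2 _] Dz; rewrite (_ : h = (fun y => ((fst \o h) y, (snd \o h) y))).
  by apply: differentiable_pair; [exact: smooth_on_diff s1 Dz|exact: smooth_on_diff s2 Dz].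
by apply/funext => y /=; case: (h y).
Qed.

End PlanarCalculus.

(** * Quaternion-valued functions on a Riemann surface *)

Section Calculus.
Variables (R : realType) (M : riemannSurface R).
Local Notation H := (quat R).
Local Notation plane := (R * R)%type.
Implicit Types (u w : M -> R) (F G : M -> H) (i j : rs_idx M) (p : M) (v : plane).

Lemma nbhs_rs_dom i p : rs_dom i p -> nbhs p (rs_dom i).
Proof. by move=> ip; apply: open_nbhs_nbhs; split=> //; exact: rs_dom_open. Qed.

Lemma codom_chart i p : rs_dom i p -> (rs_chart i @` rs_dom i) (rs_chart i p).
Proof. by exists p. Qed.

Lemma open_chart_image i (A : set M) : open A ->
  open (rs_chart i @` (rs_dom i `&` A)).
Proof.
move=> oA; rewrite openE => _ [p [ip Ap] <-]; rewrite /interior.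
have iA : nbhs (rs_chart i p) (rs_inv i @^-1` A).
  apply: (rs_inv_continuous ip); rewrite rs_chartK//; exact: open_nbhs_nbhs.
have := open_nbhs_nbhs (conj (@rs_codom_open _ M i) (codom_chart ip)).
apply: filterS2 iA => z /= Az [q iq qz]; exists q => //; split=> //.
by rewrite -qz rs_chartK in Az.
Qed.

Lemma smoothR_diff u i p : smoothR u -> rs_dom i p ->
  differentiable (u \o rs_inv i) (rs_chart i p).
Proof. by move=> su ip; apply: smooth_on_diff (su i) (codom_chart ip). Qed.

Lemma smoothR_derivable u i p v : smoothR u -> rs_dom i p ->
  derivable (u \o rs_inv i) (rs_chart i p) v.
Proof. by move=> su ip; exact: diff_derivable (smoothR_diff su ip). Qed.

Lemma smoothR_continuous u : smoothR u -> continuous u.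
Proof.
move=> su p; have [i ip] := rs_cover p.
have cu : {for p, continuous ((u \o rs_inv i) \o rs_chart i)}.
  apply: continuous_comp; first exact: rs_chart_continuous.
  exact: differentiable_continuous (smoothR_diff su ip).
have e : {near p, (u \o rs_inv i) \o rs_chart i =1 u}.
  by apply: filterS (nbhs_rs_dom ip) => q iq /=; rewrite rs_chartK.
have up : ((u \o rs_inv i) \o rs_chart i) p = u p by rewrite /= rs_chartK.
have {}cu : (u \o rs_inv i) \o rs_chart i @ p --> u p by rewrite -up; exact: cu.
exact: cvg_trans (near_eq_cvg e) cu.
Qed.

Lemma smoothR_cst (c : R) : smoothR (fun _ : M => c).
Proof. by move=> i; exact: smooth_on_cst. Qed.

Lemma smoothRD u w : smoothR u -> smoothR w -> smoothR (fun p => u p + w p).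
Proof. by move=> su sw i; exact: smooth_onD (@rs_codom_open _ M i) (su i) (sw i). Qed.

Lemma smoothRM u w : smoothR u -> smoothR w -> smoothR (fun p => u p * w p).
Proof. by move=> su sw i; exact: smooth_onM (@rs_codom_open _ M i) (su i) (sw i). Qed.

Lemma smoothRN u : smoothR u -> smoothR (fun p => - u p).
Proof.
move=> su; rewrite (_ : (fun _ => _) = fun p => (-1) * u p).
  exact: smoothRM (smoothR_cst _) su.
by apply/funext => p; rewrite mulN1r.
Qed.

Lemma smoothRB u w : smoothR u -> smoothR w -> smoothR (fun p => u p - w p).
Proof. by move=> su sw; apply: smoothRD => //; exact: smoothRN. Qed.

Lemma smoothRV u : (forall p, u p != 0) -> smoothR u -> smoothR (fun p => (u p)^-1).
Proof.
by move=> u0 su i; apply: smooth_onV (@rs_codom_open _ M i) _ (su i) => z _; exact: u0.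
Qed.

Lemma smoothH_cst (c : H) : smoothH (fun _ : M => c).
Proof. by split; exact: smoothR_cst. Qed.

Lemma smoothHD F G : smoothH F -> smoothH G -> smoothH (fun p => F p + G p).
Proof. by move=> [a b c d] [a' b' c' d']; split; apply: smoothRD. Qed.

Lemma smoothHN F : smoothH F -> smoothH (fun p => - F p).
Proof. by move=> [a b c d]; split; apply: smoothRN. Qed.

Lemma smoothHB F G : smoothH F -> smoothH G -> smoothH (fun p => F p - G p).
Proof. by move=> sF sG; apply: smoothHD => //; exact: smoothHN. Qed.

Lemma smoothHM F G : smoothH F -> smoothH G -> smoothH (fun p => F p * G p).
Proof.
move=> [a b c d] [a' b' c' d']; split.
- exact: (smoothRB (smoothRB (smoothRB (smoothRM a a') (smoothRM b b'))
    (smoothRM c c')) (smoothRM d d')).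
- exact: (smoothRB (smoothRD (smoothRD (smoothRM a b') (smoothRM b a'))
    (smoothRM c d')) (smoothRM d c')).
- exact: (smoothRD (smoothRD (smoothRB (smoothRM a c') (smoothRM b d'))
    (smoothRM c a')) (smoothRM d b')).
- exact: (smoothRD (smoothRB (smoothRD (smoothRM a d') (smoothRM b c'))
    (smoothRM c b')) (smoothRM d a')).
Qed.

Lemma smoothR_sqnormq F : smoothH F -> smoothR (fun p => sqnormq (F p)).
Proof.
move=> [a b c d].
exact: (smoothRD (smoothRD (smoothRD (smoothRM a a) (smoothRM b b))
  (smoothRM c c)) (smoothRM d d)).
Qed.

Lemma smoothHV F : (forall p, F p != 0) -> smoothH F -> smoothH (fun p => (F p)^-1).
Proof.
move=> F0 sF; have sn : smoothR (fun p => (sqnormq (F p))^-1).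
  by apply: smoothRV (smoothR_sqnormq sF) => p; rewrite sqnormq_eq0.
(* Away from 0 the ring inverse is the conjugate divided by [sqnormq], so its components are
   products of smooth functions. *)
rewrite (_ : (fun p => (F p)^-1) = fun p => Defs.invq (F p)); last first.
  by apply/funext => p; rewrite -[LHS]/(Defs.invq0 _) /Defs.invq0 (negbTE (F0 p)).
case: sF => a b c d; split.
- exact: smoothRM a sn.
- exact: smoothRM (smoothRN b) sn.
- exact: smoothRM (smoothRN c) sn.
- exact: smoothRM (smoothRN d) sn.
Qed.

Lemma dR_cst (c : R) i p v : dR (fun _ : M => c) i p v = 0.
Proof. exact: derive_cst. Qed.

Lemma dRD u w i p v : smoothR u -> smoothR w -> rs_dom i p ->
  dR (fun p => u p + w p) i p v = dR u i p v + dR w i p v.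
Proof.
by move=> su sw ip; rewrite /dR -deriveD//; exact: smoothR_derivable.
Qed.

Lemma dRN u i p v : smoothR u -> rs_dom i p ->
  dR (fun p => - u p) i p v = - dR u i p v.
Proof. by move=> su ip; rewrite /dR -deriveN//; exact: smoothR_derivable. Qed.

Lemma dRB u w i p v : smoothR u -> smoothR w -> rs_dom i p ->
  dR (fun p => u p - w p) i p v = dR u i p v - dR w i p v.
Proof. by move=> su sw ip; rewrite dRD ?dRN//; exact: smoothRN. Qed.

Lemma dRM u w i p v : smoothR u -> smoothR w -> rs_dom i p ->
  dR (fun p => u p * w p) i p v = dR u i p v * w p + u p * dR w i p v.
Proof.
move=> su sw ip; have := @deriveM R plane (u \o rs_inv i) (w \o rs_inv i)
  (rs_chart i p) v (smoothR_derivable su ip) (smoothR_derivable sw ip).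
rewrite /= !rs_chartK// => e; rewrite addrC [X in _ + X]mulrC; exact: e.
Qed.

Lemma dH_cst (c : H) i p v : dH (fun _ : M => c) i p v = 0.
Proof. by rewrite /dH; congr Quat; exact: dR_cst. Qed.

Lemma dHD F G i p v : smoothH F -> smoothH G -> rs_dom i p ->
  dH (fun p => F p + G p) i p v = dH F i p v + dH G i p v.
Proof.
by move=> [a b c d] [a' b' c' d'] ip; rewrite /dH; congr Quat; exact: dRD.
Qed.

Lemma dHN F i p v : smoothH F -> rs_dom i p ->
  dH (fun p => - F p) i p v = - dH F i p v.
Proof. by move=> [a b c d] ip; rewrite /dH; congr Quat; exact: dRN. Qed.

Lemma dHB F G i p v : smoothH F -> smoothH G -> rs_dom i p ->
  dH (fun p => F p - G p) i p v = dH F i p v - dH G i p v.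
Proof. by move=> sF sG ip; rewrite dHD ?dHN//; exact: smoothHN. Qed.

Lemma dHM F G i p v : smoothH F -> smoothH G -> rs_dom i p ->
  dH (fun p => F p * G p) i p v = dH F i p v * G p + F p * dH G i p v.
Proof.
move=> [a b c d] [a' b' c' d'] ip.
(* Spelling out the four components as real polynomials lets the rules for [dR] rewrite them. *)
have re : dR (@qre R \o (fun p => F p * G p)) i p v = dR (fun p =>
    qre (F p) * qre (G p) - qi (F p) * qi (G p) - qj (F p) * qj (G p)
    - qk (F p) * qk (G p)) i p v by [].
have im : dR (@qi R \o (fun p => F p * G p)) i p v = dR (fun p =>
    qre (F p) * qi (G p) + qi (F p) * qre (G p) + qj (F p) * qk (G p)
    - qk (F p) * qj (G p)) i p v by [].
have jm : dR (@qj R \o (fun p => F p * G p)) i p v = dR (fun p =>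
    qre (F p) * qj (G p) - qi (F p) * qk (G p) + qj (F p) * qre (G p)
    + qk (F p) * qi (G p)) i p v by [].
have km : dR (@qk R \o (fun p => F p * G p)) i p v = dR (fun p =>
    qre (F p) * qk (G p) + qi (F p) * qj (G p) - qj (F p) * qi (G p)
    + qk (F p) * qre (G p)) i p v by [].
rewrite {1}/dH re im jm km !(dRB, dRD, dRM)//.
2-25: by do ?[exact: smoothRM | apply: smoothRB | apply: smoothRD].
rewrite /dH /comp; do 8 move: (dR _ i p v) => ?.
by case: (F p) (G p) => ? ? ? ? [? ? ? ?]; congr Quat => /=; ring.
Qed.

(** For the coefficient in Gronwall's inequality, which has to be continuous along segments. *)
Lemma dR_diff u i v z : smoothR u -> (rs_chart i @` rs_dom i) z ->
  differentiable (fun y => dR u i (rs_inv i y) v) z.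
Proof.
move=> su iz; have := smooth_on_diff (smooth_on_derive v (su i)) iz.
apply: near_eq_differentiable.
have := open_nbhs_nbhs (conj (@rs_codom_open _ M i) iz).
by apply: filterS => _ [q iq <-]; rewrite /dR rs_chartK.
Qed.

Lemma dR_sqnormq F i p v : smoothH F -> rs_dom i p ->
  dR (fun p => sqnormq (F p)) i p v =
  2 * (qre (F p) * qre (dH F i p v) + qi (F p) * qi (dH F i p v) +
       qj (F p) * qj (dH F i p v) + qk (F p) * qk (dH F i p v)).
Proof.
move=> [a b c d] ip.
rewrite (_ : (fun p => sqnormq (F p)) = fun p => qre (F p) * qre (F p) +
    qi (F p) * qi (F p) + qj (F p) * qj (F p) + qk (F p) * qk (F p)) //.
rewrite !(dRB, dRD, dRM)//.
2-7: by do ?[exact: smoothRM | apply: smoothRB | apply: smoothRD].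
by rewrite /dH /= /comp; do 4 move: (dR _ i p v) => ?; ring.
Qed.

Lemma dR_sqnormq_le F i p v : smoothH F -> rs_dom i p ->
  dR (fun p => sqnormq (F p)) i p v <= sqnormq (F p) + sqnormq (dH F i p v).
Proof.
move=> sF ip; rewrite dR_sqnormq// /sqnormq.
move: (dH F i p v) (F p) => [a b c d] [a' b' c' d'] /=.
have := sqr_ge0 (a - a'); have := sqr_ge0 (b - b').
have := sqr_ge0 (c - c'); have := sqr_ge0 (d - d'); nra.
Qed.

End Calculus.

(** * Zeros of solutions of linear equations *)

Section Gronwall.
Variable R : realType.

(** The integrating factor [exp (- K t)] makes the product [phi * e] nonincreasing. *)
Lemma gronwall_le0 (phi : R -> R) (K : R) :
  (forall t, 0 <= t <= 1 -> derivable phi t 1) ->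
  (forall t, 0 <= t <= 1 -> 'D_1 phi t <= K * phi t) ->
  phi 0 <= 0 -> phi 1 <= 0.
Proof.
move=> dphi phiK phi0; pose e := fun t : R => expR (- K * t).
have de (t : R) : is_derive t 1 e (- K * e t).
  have dl : is_derive t 1 ( *%R (- K)) (- K).
    by rewrite -[X in is_derive _ _ _ X]mulr1; exact: (@is_deriveZ R R R id).
  have := is_derive1_comp (is_derive_expR (- K * t)) dl.
  by rewrite mulrC; apply.
have dpsi t : 0 <= t <= 1 -> derivable (phi * e) t 1.
  by move=> t01; apply: derivableM => //; exact: dphi.
have : (phi * e) 1 <= (phi * e) 0.
  apply: (@ler0_derive1_nincr R (phi * e) 0 1) => //.
  - by move=> t /[!in_itv]/= /andP[t0 t1]; apply: dpsi; rewrite !ltW.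
  - move=> t /[!in_itv]/= /andP[t0 t1]; have t01 : 0 <= t <= 1 by rewrite !ltW.
    rewrite derive1E deriveM//; last exact: dphi.
    rewrite derive_val /GRing.scale/=.
    have -> : phi t * (- K * e t) + e t * 'D_1 phi t = e t * ('D_1 phi t - K * phi t) by ring.
    by rewrite pmulr_rle0 ?expR_gt0// subr_le0; exact: phiK.
  - by apply: derivable_within_continuous => t /[!in_itv]/=; exact: dpsi.
move=> le1; have {le1} : phi 1 * e 1 <= phi 0 * e 0 := le1.
rewrite /e mulr0 expR0 mulr1 => /le_trans/(_ phi0).
by rewrite pmulr_lle0// expR_gt0.
Qed.

Lemma derive_line (F : R * R -> R) (z v : R * R) (t : R) :
  (derivable F (t *: v + z) v -> derivable (fun s : R => F (s *: v + z)) t 1) /\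
  'D_1 (fun s : R => F (s *: v + z)) t = 'D_v F (t *: v + z).
Proof.
have e : (fun h : R => h^-1 *: (((fun s : R => F (s *: v + z)) \o shift t) (h *: 1)
    - F (t *: v + z))) = (fun h : R => h^-1 *: ((F \o shift (t *: v + z)) (h *: v)
    - F (t *: v + z))).
  by apply/funext => h /=; rewrite addrA -scalerDl [h *: 1]mulr1.
by rewrite /derivable /derive e.
Qed.

(** On the segment [G] is bounded by its maximum, and [F >= 0] allows [G] to be replaced by this
    constant. *)
Lemma gronwall_segment (F G : R * R -> R) (z v : R * R) :
  (forall t : R, 0 <= t <= 1 -> differentiable F (t *: v + z)) ->
  (forall t : R, 0 <= t <= 1 -> differentiable G (t *: v + z)) ->
  (forall t : R, 0 <= t <= 1 ->
    0 <= F (t *: v + z) /\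
    'D_v F (t *: v + z) <= G (t *: v + z) * F (t *: v + z)) ->
  F z <= 0 -> F (v + z) <= 0.
Proof.
move=> dF dG FG Fz.
pose g (t : R) := G (t *: v + z).
have cg : {within `[0, 1], continuous g}.
  apply: derivable_within_continuous => t /[!in_itv]/= t01.
  by apply: (derive_line G z v t).1; exact: diff_derivable (dG _ t01).
have [c _ maxg] := EVT_max ler01 cg.
have := @gronwall_le0 (fun t : R => F (t *: v + z)) (g c).
rewrite scale0r add0r scale1r; apply=> // t t01.
  by apply: (derive_line F z v t).1; exact: diff_derivable (dF _ t01).
rewrite (derive_line F z v t).2; have [F0 le] := FG _ t01.
by apply: le_trans le _; apply: ler_wpM2r => //; apply: maxg; rewrite in_itv.
Qed.

End Gronwall.

Section Vanishing.
Variables (R : realType) (M : riemannSurface R).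
Local Notation H := (quat R).

Lemma sqnormq_ge0 (x : H) : 0 <= sqnormq x.
Proof. by rewrite /sqnormq !addr_ge0// sqr_ge0. Qed.

(* Gronwall's inequality along the segments of a chart shows that the zero set is open. *)
Lemma zero_set_all (al F : M -> H) (C : R) (p0 : M) :
  smoothH al -> smoothH F -> 0 <= C ->
  (forall i p v, rs_dom i p ->
    sqnormq (dH al i p v) <= C * sqnormq (dH F i p v) * sqnormq (al p)) ->
  al p0 = 0 -> forall p, al p = 0.
Proof.
move=> sal sF C0 alF al0.
have sn := smoothR_sqnormq sal.
pose Z := [set p | al p = 0].
suff : Z = setT by move=> ZT p; rewrite -[al p = 0]/(Z p) ZT.
(* By connectedness it suffices that [Z] is nonempty, open and closed. *)
apply: (@rs_connected _ M); first by exists p0.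
- exists Z; last by rewrite setTI.
  rewrite openE => p Zp; rewrite /interior.
  have [i ip] := rs_cover p; pose z := rs_chart i p.
  have := open_nbhs_nbhs (conj (@rs_codom_open _ M i) (codom_chart ip)).
  rewrite -/z -nbhs_ballE => -[e /= e0 zD].
  have zb : nbhs p (rs_chart i @^-1` ball z e).
    by apply: (rs_chart_continuous ip); exact: nbhsx_ballx.
  apply: filterS2 (nbhs_rs_dom ip) zb => q iq /= zq; rewrite /Z /=.
  pose v := rs_chart i q - z.
  have seg t : 0 <= t <= 1 -> (rs_chart i @` rs_dom i) (t *: v + z).
    move=> /andP[t0 t1]; apply: zD; move: zq; rewrite -ball_normE /= => zq.
    rewrite opprD addrCA subrr addr0 normrN normrZ ger0_norm//.
    by apply: le_lt_trans zq; rewrite distrC -/v ler_piMl.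
  have nq : (rs_inv i (v + z)) = q by rewrite /v subrK rs_chartK.
  have nz : rs_inv i z = p by rewrite rs_chartK.
  apply/eqP; rewrite -sqnormq_eq0 eq_le sqnormq_ge0 andbT -nq.
  pose F1 := (fun p => sqnormq (al p)) \o rs_inv i.
  (* [S] is [sqnormq] of the differential of [F] in the fixed direction [v], read in the chart. The
     summand 1 in [G1] comes from [dR_sqnormq_le]. *)
  pose S (y : R * R) := dR (@qre R \o F) i (rs_inv i y) v ^+ 2 +
     dR (@qi R \o F) i (rs_inv i y) v ^+ 2 + dR (@qj R \o F) i (rs_inv i y) v ^+ 2 +
     dR (@qk R \o F) i (rs_inv i y) v ^+ 2.
  pose G1 y := 1 + C * S y.
  apply: (@gronwall_segment R F1 G1) => [t /seg t01|t /seg t01|t /seg t01|].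
  + exact: smooth_on_diff (sn i) t01.
  + have [a b c d] := sF.
    have [da db] := (dR_diff v a t01, dR_diff v b t01).
    have [dc dd] := (dR_diff v c t01, dR_diff v d t01).
    have sqr (h : R * R -> R) : differentiable h (t *: v + z) ->
        differentiable (fun y => h y ^+ 2) (t *: v + z).
      by move=> dh; have := @differentiableX _ _ _ 1 _ dh; rewrite exprfctE.
    have dS : differentiable S (t *: v + z).
      exact: (differentiableD (differentiableD (differentiableD (sqr _ da) (sqr _ db))
        (sqr _ dc)) (sqr _ dd)).
    have dC := differentiableM (@differentiable_cst _ _ _ C (t *: v + z)) dS.
    exact: differentiableD (@differentiable_cst _ _ _ (1 : R) (t *: v + z)) dC.
  + split; first exact: sqnormq_ge0.
    case: t01 => p' ip' <-.
    have := dR_sqnormq_le v sal ip'; rewrite /dR => /le_trans; apply.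
    rewrite /G1 /F1 /S /= !rs_chartK// mulrDl mul1r lerD2l.
    exact: alF.
  + by rewrite /F1 /= nz Zp /sqnormq /= expr0n /= !addr0.
- exists Z; last by rewrite setTI.
  rewrite (_ : Z = (fun p => sqnormq (al p)) @^-1` [set 0]).
    apply: closed_comp; last exact: closed_eq.
    by move=> p _; exact: smoothR_continuous.
  apply/seteqP; split=> p /= /eqP pz; apply/eqP; first by rewrite sqnormq_eq0.
  by rewrite -sqnormq_eq0.
Qed.

(** This is [zero_set_all] with [C = 0], applied to [F - G] minus its value at a base point. *)
Lemma dH_eq_cst (F G : M -> H) : smoothH F -> smoothH G ->
  eq_form (dH F) (dH G) -> eq_up_to_translation F G.
Proof.
move=> sF sG dFG; have [p0 _] := rs_nonempty M.
exists (F p0 - G p0); apply/funext => p; rewrite /translate.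
have sFG := smoothHB sF sG.
have := @zero_set_all (fun p => F p - G p - (F p0 - G p0)) (fun=> 0) 0 p0
  (smoothHB sFG (smoothH_cst _ _)) (smoothH_cst _ 0) (lexx _).
rewrite subrr => /(_ _ erefl p) h.
have /subr0_eq <- : F p - G p - (F p0 - G p0) = 0; last by rewrite addrC subrK.
apply: h => i q v iq; rewrite (dHB _ sFG (smoothH_cst _ _) iq) dH_cst subr0.
by rewrite (dHB _ sF sG iq) dFG// subrr /sqnormq /= expr0n /= !addr0 !mul0r.
Qed.
End Vanishing.

(** * Pullback along a covering *)

Section Pullback.
Variable R : realType.
Local Notation H := (quat R).
Local Notation plane := (R * R)%type.

Section HolomorphicMap.
Variables (M M' : riemannSurface R) (A : set M) (F : M -> M').
Hypotheses (oA : open A) (hF : holomorphic_map A F).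

Definition chart_rep (i : rs_idx M) (j : rs_idx M') := rs_chart j \o F \o rs_inv i.

Lemma open_chart_rep_dom i j :
  open (rs_chart i @` (rs_dom i `&` A `&` (F @^-1` rs_dom j))).
Proof.
rewrite -setIA; apply: open_chart_image; rewrite openE => p [Ap jp].
apply: filterI; first exact: open_nbhs_nbhs.
by apply: (hF.1 _ Ap); exact: nbhs_rs_dom.
Qed.

Lemma chart_rep_domP i j p : rs_dom i p -> A p -> rs_dom j (F p) ->
  (rs_chart i @` (rs_dom i `&` A `&` (F @^-1` rs_dom j))) (rs_chart i p).
Proof. by exists p. Qed.

Lemma chart_rep_diff i j p : rs_dom i p -> A p -> rs_dom j (F p) ->
  differentiable (chart_rep i j) (rs_chart i p).
Proof.
by move=> ip Ap jp; apply: holomorphic_on_diff (hF.2 i j) (chart_rep_domP ip Ap jp).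
Qed.

Lemma dR_comp (u : M' -> R) i j p v : smoothR u ->
  rs_dom i p -> A p -> rs_dom j (F p) ->
  dR (u \o F) i p v = dR u j (F p) ('d (chart_rep i j) (rs_chart i p) v).
Proof.
move=> su ip Ap jp; have dh := chart_rep_diff ip Ap jp.
have hp : chart_rep i j (rs_chart i p) = rs_chart j (F p).
  by rewrite /chart_rep /= rs_chartK.
have du := smoothR_diff su jp; rewrite -hp in du.
rewrite /dR (@near_eq_derive _ _ _ _ ((u \o rs_inv j) \o chart_rep i j)); last first.
  have := open_nbhs_nbhs (conj (@open_chart_rep_dom i j) (chart_rep_domP ip Ap jp)).
  apply: filterS => _ [q [[iq Aq] jq] <-].
  by rewrite /chart_rep /= rs_chartK// rs_chartK.
rewrite deriveE; last exact: differentiable_comp.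
by rewrite diff_comp//= -deriveE// hp.
Qed.

End HolomorphicMap.

Section Covering.
Variables (Mt M : riemannSurface R) (pi : Mt -> M).
Hypothesis hpi : holomorphic_covering pi.

Lemma smoothR_comp (u : M -> R) : smoothR u -> smoothR (u \o pi).
Proof.
move=> su i; apply: smooth_on_local => _ [p ip <-].
have [j jp] := rs_cover (pi p).
exists (rs_chart i @` (rs_dom i `&` setT `&` (pi @^-1` rs_dom j))).
  exact: chart_rep_domP.
have oD := @open_chart_rep_dom Mt M setT pi openT hpi.1 i j.
have [s1 s2 _] := hpi.1.2 i j.
apply: eq_smooth_on (smooth_on_comp oD _ s1 s2 (su j)) => //.
- by move=> _ [q [[iq _] jq] <-] /=; rewrite !rs_chartK.
- by move=> _ [q [[iq _] jq] <-] /=; rewrite rs_chartK//; exists (pi q).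
Qed.

Lemma smoothH_comp (F : M -> H) : smoothH F -> smoothH (F \o pi).
Proof.
move=> [a b c d]; split; [exact: (smoothR_comp a)|exact: (smoothR_comp b)|
  exact: (smoothR_comp c)|exact: (smoothR_comp d)].
Qed.

Lemma dH_comp (F : M -> H) i j p v : smoothH F ->
  rs_dom i p -> rs_dom j (pi p) ->
  dH (F \o pi) i p v = dH F j (pi p) ('d (chart_rep pi i j) (rs_chart i p) v).
Proof.
by move=> [a b c d] ip jp; rewrite /dH; congr Quat;
  exact: (@dR_comp Mt M setT pi openT hpi.1 _ i j).
Qed.

Lemma chart_rep_Jplane i j p v : rs_dom i p -> rs_dom j (pi p) ->
  'd (chart_rep pi i j) (rs_chart i p) (Jplane v) =
  Jplane ('d (chart_rep pi i j) (rs_chart i p) v).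
Proof.
move=> ip jp; have [_ _ h] := hpi.1.2 i j.
exact: h (chart_rep_domP ip I jp).
Qed.

(** The local inverse [sigma k] is differentiable, and in charts its composite with [pi] is the
    identity near the point, so a vector killed by the differential is 0. *)
Lemma covering_diff_neq0 i j p v : rs_dom i p -> rs_dom j (pi p) -> v != 0 ->
  'd (chart_rep pi i j) (rs_chart i p) v != 0.
Proof.
move=> ip jp; apply: contra_neq => dv0.
have [V [K [U [sigma [[oV Vp] piV _ hU]]]]] := hpi.2 (pi p).
have : (pi @^-1` V) p by [].
rewrite piV => -[k _ Ukp]; have [oU hs _ sK] := hU k.
have dh := chart_rep_diff hpi.1 ip I jp.
have hp : chart_rep pi i j (rs_chart i p) = rs_chart j (pi p).
  by rewrite /chart_rep /= rs_chartK.
have dh' : differentiable (chart_rep (sigma k) j i) (rs_chart j (pi p)).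
  by apply: (chart_rep_diff hs) => //; rewrite sK.
rewrite -hp in dh'.
have e : 'D_v (chart_rep (sigma k) j i \o chart_rep pi i j) (rs_chart i p) = v.
  rewrite -[RHS](derive_id (rs_chart i p) v); apply: near_eq_derive.
  have oUj : open (U k `&` setT `&` (pi @^-1` rs_dom j)).
    rewrite setIT openE => q [Uq jq]; apply: filterI; first exact: open_nbhs_nbhs.
    by apply: (hpi.1.1 q) => //; exact: nbhs_rs_dom.
  have pU : (rs_chart i @` (rs_dom i `&` (U k `&` setT `&` pi @^-1` rs_dom j)))
    (rs_chart i p) by exists p.
  have := open_nbhs_nbhs (conj (@open_chart_image R Mt i _ oUj) pU).
  apply: filterS => _ [q [iq [[Uq _] jq]] <-].
  by rewrite /chart_rep /= rs_chartK// rs_chartK// sK.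
rewrite -e deriveE; last exact: differentiable_comp.
have dE := congr1 (fun L => L v) (diff_comp dh dh').
have lin0 (L : {linear plane -> plane}) : L 0 = 0 by exact: linear0.
exact: etrans dE (etrans (congr1 ('d _ _) dv0) (lin0 _)).
Qed.

(** In charts the differential of [pi] is injective and commutes with [Jplane], so every clause of
    [cmc_surface] pulls back. *)
Lemma cmc_surface_comp (f N : M -> H) :
  cmc_surface f N -> cmc_surface (f \o pi) (N \o pi).
Proof.
move=> [[sf imf] [sN S2N] immf [sl sr] H1]; split.
- by split=> [|p]; [exact: smoothH_comp|exact: imf].
- by split=> [|p]; [exact: smoothH_comp|exact: S2N].
- move=> i p v ip v0; have [j jp] := rs_cover (pi p).
  by rewrite (dH_comp _ sf ip jp) immf// covering_diff_neq0.
- split=> i p v ip; have [j jp] := rs_cover (pi p).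
    by rewrite /star /lmulf !(dH_comp _ sf ip jp) chart_rep_Jplane//; exact: sl.
  by rewrite /star /rmulf !(dH_comp _ sf ip jp) chart_rep_Jplane//; exact: sr.
- move=> i p v ip; have [j jp] := rs_cover (pi p).
  rewrite /lmulf /star (dH_comp _ sf ip jp) !(dH_comp _ sN ip jp) chart_rep_Jplane//.
  exact: H1.
Qed.

End Covering.
End Pullback.

(** * Quaternionic algebra *)

Section Algebra.
Variable R : realType.
Local Notation H := (quat R).
Local Notation C := (complex R).
Implicit Types (x y : H) (u w z mu lam : C).

Lemma quat_unitE x : (x \is a GRing.unit) = (x != 0).
Proof. by []. Qed.

Lemma quat_mulf_neq0 x y : x != 0 -> y != 0 -> x * y != 0.
Proof. by rewrite -!quat_unitE => ux uy; rewrite unitrMl. Qed.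

Lemma qCD u w : qC (u + w) = qC u + qC w.
Proof. by case: u w => a b [c d]; rewrite /qC /=; congr Quat; rewrite addr0. Qed.

Lemma qCN u : qC (- u) = - qC u.
Proof. by case: u => a b; rewrite /qC /=; congr Quat; rewrite oppr0. Qed.

Lemma qCM u w : qC (u * w) = qC u * qC w.
Proof. case: u w => a b [c d]; rewrite /qC /=; congr Quat => /=.
all: ring. Qed.

Lemma qC1 : qC (1 : C) = 1.
Proof. by []. Qed.

Lemma qC0 : qC (0 : C) = 0.
Proof. by []. Qed.

Lemma qC_eq0 u : (qC u == 0) = (u == 0).
Proof.
apply/eqP/eqP => [|->//]; case: u => a b; rewrite /qC /= => -[-> ->].
by [].
Qed.

Lemma qCV u : qC u^-1 = (qC u)^-1.
Proof.
have [->|u0] := eqVneq u 0; first by rewrite invr0 qC0 invr0.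
have uq : qC u \is a GRing.unit by rewrite quat_unitE qC_eq0.
by apply: (mulrI uq); rewrite divrr// -qCM mulfV.
Qed.

Lemma qCC u w : qC u * qC w = qC w * qC u.
Proof. by rewrite -!qCM mulrC. Qed.

Lemma qC_half : qC (2^-1 : C) = 2^-1.
Proof. by rewrite qCV; congr (_^-1); rewrite qCD. Qed.

Lemma halfC x : 2^-1 * x = x * 2^-1.
Proof. by apply: commr_sym; apply: commrV; exact: commr_nat. Qed.

Lemma qreC x y : qre (x * y) = qre (y * x).
Proof. by case: x y => a b c d [a' b' c' d'] /=; ring. Qed.

Lemma qre_conj x y : x != 0 -> qre (x * y * x^-1) = qre y.
Proof. by rewrite -quat_unitE => ux; rewrite qreC mulrA mulVr// mul1r. Qed.

Lemma sqr_conj x y : x != 0 -> (x * y * x^-1) * (x * y * x^-1) = x * (y * y) * x^-1.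
Proof. by rewrite -quat_unitE => ux; rewrite !mulrA divrK. Qed.

Lemma sphere2_conj x y : x != 0 -> sphere2 y -> sphere2 (x * y * x^-1).
Proof.
move=> x0 [imy yy]; split; first exact: etrans (qre_conj _ x0) imy.
by rewrite sqr_conj// yy mulrN1 mulNr divrr.
Qed.

(** A Cayley transform of the spectral parameter, by [cayE]. At [z = 1] the denominator is 0, so
    that parameter is treated apart. *)
Definition cay (z : C) : C := b_ z / (a_ z - 1).

Lemma C_i2 : (Complex 0 1 : C) ^+ 2 = -1.
Proof. by apply/eqP; rewrite expr2 eq_complex /=; apply/andP; split; apply/eqP; ring. Qed.

Lemma a_sub1E z : z != 0 -> a_ z - 1 = (z - 1) ^+ 2 / (2 * z).
Proof. by move=> z0; rewrite /a_; field. Qed.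

Lemma a_sub1_neq0 z : z != 0 -> z != 1 -> a_ z - 1 != 0.
Proof.
move=> z0 z1; rewrite a_sub1E// mulf_neq0//; first by rewrite expf_neq0// subr_eq0.
by rewrite invr_neq0// mulf_neq0// pnatr_eq0.
Qed.

Lemma cayE z : z != 0 -> z != 1 -> cay z = Complex 0 1 * (1 + z) / (1 - z).
Proof.
move=> z0 z1; rewrite /cay a_sub1E// /b_; field.
by rewrite z0 !subr_eq0 z1 eq_sym z1.
Qed.

(* This is [a_ z ^+ 2 + b_ z ^+ 2 = 1], divided by [a_ z - 1]. *)
Lemma cay_sqr z : z != 0 -> z != 1 -> (1 + cay z ^+ 2) * ((a_ z - 1) / 2) = -1.
Proof.
move=> z0 z1; rewrite cayE// a_sub1E// !exprMn C_i2; field.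
by rewrite z0 subr_eq0 eq_sym z1.
Qed.

(** As functions of [lam], both sides of the formula are Moebius maps with zero [mu], pole
    [(conjc mu)^-1] and limit 1 at [lam = 1]; indeed [conjc (cay mu)] is the value of [cay] at
    [(conjc mu)^-1]. *)
Lemma gammaE mu lam : mu != 0 -> mu != 1 -> lam != 0 -> lam != 1 ->
  lam != (conjc mu)^-1 ->
  cay lam - conjc (cay mu) != 0 /\
  gamma_ mu lam = (cay lam - cay mu) / (cay lam - conjc (cay mu)).
Proof.
move=> m0 m1 l0 l1; rewrite !cayE// /gamma_.
rewrite !rmorphM /= fmorphV rmorphB rmorphD !rmorph1 /=.
have -> : (Complex 0 (-1) : C) = - Complex 0 1 by rewrite -[RHS]/(Complex _ _) oppr0.
have i0 : (Complex 0 1 : C) != 0 by rewrite eq_complex /= oner_eq0 andbF.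
have c0 : conjc mu != 0 by rewrite fmorph_eq0.
have c1 : conjc mu != 1 by rewrite -(rmorph1 (@conjc R)) (inj_eq (fmorph_inj _)).
(* From here on [conjc mu] and the imaginary unit are independent atoms for [field]. *)
move: (conjc mu) c0 c1 (Complex 0 1) i0 => m' c0 c1 i i0 lm.
have lm' : lam * m' - 1 != 0.
  by rewrite subr_eq0; apply: contra_neq lm => e; apply: (mulIf c0); rewrite e mulVf.
have e : i * (1 + lam) / (1 - lam) - - i * (1 + m') / (1 - m') =
    2 * i * (1 - lam * m') / ((1 - lam) * (1 - m')).
  by field; rewrite !subr_eq0 ![1 == _]eq_sym l1 c1.
have l1' : 1 - lam != 0 by rewrite subr_eq0 eq_sym.
have c1' : 1 - m' != 0 by rewrite subr_eq0 eq_sym.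
have m1' : 1 - mu != 0 by rewrite subr_eq0 eq_sym.
have lm2 : 1 - lam * m' != 0 by rewrite -oppr_eq0 opprB.
split; first by rewrite e !mulf_neq0 ?pnatr_eq0 ?invr_neq0 ?mulf_neq0.
rewrite e; field.
by rewrite l1' lm2 i0 m1' c0 lm' c1'.
Qed.

Lemma qC_unit u : u != 0 -> qC u \is a GRing.unit.
Proof. by move=> u0; rewrite quat_unitE qC_eq0. Qed.

Lemma qC_cay_sqr mu : mu != 0 -> mu != 1 ->
  (1 + qC (cay mu) * qC (cay mu)) * qC ((a_ mu - 1) / 2) = -1.
Proof.
by move=> m0 m1; rewrite -qCM -qC1 -qCD -qCM -qCN -expr2 cay_sqr.
Qed.

(** Pulling out [a - 1] leaves a single parameter [cay lam] inside the bracket; all later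
    computations use this form. *)
Lemma beta_val x y lam : lam != 0 -> lam != 1 ->
  2^-1 * (x * y * qC (a_ lam - 1) + y * qC (b_ lam)) =
  (x * y + y * qC (cay lam)) * qC ((a_ lam - 1) / 2).
Proof.
move=> l0 l1; have -> : qC (b_ lam) = qC (cay lam) * qC (a_ lam - 1).
  by rewrite -qCM /cay divfK// a_sub1_neq0.
by rewrite halfC mulrA -mulrDl qCM qC_half mulrA.
Qed.

Lemma quat_ext x y : qre x = qre y -> qi x = qi y -> qj x = qj y -> qk x = qk y ->
  x = y.
Proof. by case: x y => a b c d [a' b' c' d'] /= -> -> -> ->. Qed.

Lemma quat_compD x y : (qre (x + y) = qre x + qre y) * (qi (x + y) = qi x + qi y) *
  (qj (x + y) = qj x + qj y) * (qk (x + y) = qk x + qk y).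
Proof. by []. Qed.

Lemma quat_compN x : (qre (- x) = - qre x) * (qi (- x) = - qi x) *
  (qj (- x) = - qj x) * (qk (- x) = - qk x).
Proof. by []. Qed.

End Algebra.

(* A locked copy of the product: it keeps [ring] from unfolding the monomials. *)
Definition qmul (R : realType) : quat R -> quat R -> quat R :=
  locked (fun x y => x * y).

Lemma qmulE (R : realType) (x y : quat R) : x * y = qmul x y.
Proof. by rewrite /qmul -lock. Qed.

(* Decides equalities of integral linear combinations of quaternionic monomials. *)
Ltac quat_abel :=
  repeat match goal with
  | |- context [@dH ?A ?M ?F ?i ?p ?v] => generalize (@dH A M F i p v); intro
  end;
  rewrite ?(mulrDl, mulrDr, mulrN, mulNr, mulr1, mul1r, opprK, mulrA) ?qmulE;
  repeat match goal with
  | |- context [@qmul ?A ?x ?y] => generalize (@qmul A x y); intro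
  end;
  apply: quat_ext; rewrite ?(quat_compD, quat_compN); ring.

(** * Pointwise identities between [N], [al], [be], [chat] and [T] *)

Section Pointwise.
Variable R : realType.
Local Notation H := (quat R).
Variables (N al c k be chat T : H).
Hypotheses (NN : N * N = -1) (al0 : al != 0).
Hypotheses (ck : c * k = k * c) (cck : (1 + c * c) * k = -1).
Hypotheses (beE : be = (N * al + al * c) * k) (chatE : chat = al * c * al^-1).
Hypothesis TE : T = al / be.

Lemma cck' : c * c * k = - 1 - k.
Proof. by rewrite -cck mulrDl mul1r addrAC subrr add0r. Qed.

(** Left multiplication by [N] turns [(N al + al c) k] into [- al k + N al c k]; the relation
    [c c k = - 1 - k] identifies this with the right-hand side. *)
Lemma N_beta : N * be = al + be * c.
Proof.
have ckc : k * c = c * k by [].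
rewrite beE !(mulrDl, mulrDr) !mulrA NN -!(mulrA _ k c) ckc !mulrA.
rewrite -!(mulrA _ c c) -(mulrA al) cck'; quat_abel.
Qed.

Let ual : al \is a GRing.unit. Proof. by []. Qed.

Lemma k_unit : k \is a GRing.unit.
Proof.
rewrite quat_unitE; apply/eqP => k0; move/eqP: cck.
by rewrite k0 mulr0 eq_sym oppr_eq0 oner_eq0.
Qed.

Lemma alk_unit : al * k \is a GRing.unit.
Proof. by rewrite unitrMl// k_unit. Qed.

(** With [be = 0], [N_beta] would give [al = 0]. *)
Lemma beta_neq0 : be != 0.
Proof.
apply/eqP => be0; have := N_beta; rewrite be0 mulr0 mul0r addr0 => /esym/eqP.
by apply/negP.
Qed.

Let ube : be \is a GRing.unit. Proof. exact: beta_neq0. Qed.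

Lemma chat_al : chat * al = al * c.
Proof. by rewrite chatE divrK. Qed.

Lemma beta_chat : be = (N + chat) * (al * k).
Proof. by rewrite beE [RHS]mulrA [in RHS]mulrDl chat_al. Qed.

(** The left-hand side is the value of [beta_of] at [be] for the parallel surface; by [N_beta] the
    terms in [be c] cancel. *)
Lemma beta_g : (- N * be + be * c) * k = - (al * k).
Proof. by rewrite mulNr N_beta; quat_abel. Qed.

Lemma beta_div_beta_g : be * (- (al * k))^-1 = - (N + chat).
Proof. by rewrite invrN mulrN beta_chat mulrK ?alk_unit. Qed.

Lemma N_chat_unit : N + chat \is a GRing.unit.
Proof. by rewrite -(unitrMl _ alk_unit) -beta_chat. Qed.

Lemma T_unit : T \is a GRing.unit.
Proof. by rewrite TE unitrMl// unitrV. Qed.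

Lemma invT : T^-1 = be / al.
Proof. by rewrite TE invrM ?unitrV// invrK. Qed.

Lemma T_beta : T * be = al.
Proof. by rewrite TE divrK. Qed.

Lemma NhE : T * N * T^-1 = T + chat.
Proof.
rewrite invT -mulrA [N * _]mulrA N_beta mulrDl divrr// mulrDr mulr1.
by rewrite -[be * c / al]mulrA [T * _]mulrA T_beta chatE mulrA.
Qed.

(** Multiplying by [al * k] turns [N + chat] into [be], and [cck'] removes [c * c]. The identity
    gives the dressed surface its left conformality. *)
Lemma Nh_Tg : (T * N * T^-1) * (N + chat) = (N + chat) * N.
Proof.
apply: (mulIr alk_unit); rewrite NhE -mulrA -beta_chat mulrDl T_beta beta_chat.
have -> : chat * ((N + chat) * (al * k)) = chat * N * al * k + al * (c * c * k).
  by rewrite mulrDl mulrDr !mulrA -(mulrA chat chat) chat_al !mulrA chat_al.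
have -> : (N + chat) * N * (al * k) = N * N * al * k + chat * N * al * k.
  by rewrite !mulrDl !mulrA.
rewrite cck' NN; quat_abel.
Qed.

End Pointwise.

(** * The dressing gauge at a point *)

Section Gauge.
Variable R : realType.
Local Notation H := (quat R).

(** A complex [w] commutes with elements of [C], and becomes [conjc w] when moved from the left to
    the right of an element of [C j]. *)
Lemma gauge_split (z : H) (u w : complex R) :
  Quat (qre z) (qi z) 0 0 * qC (u - w) + Quat 0 0 (qj z) (qk z) * qC (u - conjc w) =
  z * qC u - qC w * z.
Proof.
by case: z u w => a b c d [u1 u2] [w1 w2]; apply: quat_ext => /=; ring.
Qed.

(* On E the complex number [u - w] and on E j the number [u - conjc w] is the
   effect of [x |-> x u - (al w al^-1) x], which gives r_lambda up to scale. *)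
Lemma gaugeE (al y : H) (mu lam : complex R) : al != 0 ->
  mu != 0 -> mu != 1 -> lam != 0 -> lam != 1 -> lam != (conjc mu)^-1 ->
  projE al y * qC (gamma_ mu lam) + projEj al y =
  (y * qC (cay lam) - al * qC (cay mu) * al^-1 * y) *
  qC (cay lam - conjc (cay mu))^-1.
Proof.
rewrite -quat_unitE => ual m0 m1 l0 l1 lm.
have [K0 gE] := gammaE m0 m1 l0 l1 lm.
have uK := qC_unit K0.
apply: (mulIr uK); rewrite qCV mulrVK// mulrDl -[projE _ _ * _ * _]mulrA -qCM gE divfK//.
pose z := al^-1 * y.
have -> : projE al y = al * Quat (qre z) (qi z) 0 0 by [].
have -> : projEj al y = al * Quat 0 0 (qj z) (qk z) by [].
rewrite -(mulrA al) -(mulrA al _ (qC _)) -mulrDr gauge_split mulrBr mulrA mulVKr//.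
by rewrite /z !mulrA.
Qed.

(** [gaugeE] excludes [lam = 1]; there [gamma_ mu 1 = 1] and the two projections add up to the
    identity. *)
Lemma gauge_id (mu lam : complex R) (al y : H) : mu != 1 -> lam = 1 -> al != 0 ->
  projE al y * qC (gamma_ mu lam) + projEj al y = y.
Proof.
rewrite -quat_unitE => m1 -> ual.
have c1 : conjc mu != 1 by rewrite -(rmorph1 (@conjc R)) (inj_eq (fmorph_inj _)).
have -> : gamma_ mu 1 = 1.
  rewrite /gamma_ mulrA divfK ?subr_eq0 1?eq_sym// divff//.
  by rewrite subr_eq0 eq_sym -[1]invr1 (inj_eq invr_inj).
rewrite qC1 mulr1 -[LHS]/(al * Quat (qre (al^-1 * y)) (qi (al^-1 * y)) 0 0 +
  al * Quat 0 0 (qj (al^-1 * y)) (qk (al^-1 * y))) -mulrDr.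
have -> : Quat (qre (al^-1 * y)) (qi (al^-1 * y)) 0 0 +
    Quat 0 0 (qj (al^-1 * y)) (qk (al^-1 * y)) = al^-1 * y.
  by case: (al^-1 * y) => a b c d; apply: quat_ext => /=; rewrite ?addr0 ?add0r.
by rewrite mulVKr.
Qed.

(** After cancelling [ds] and the factor [K], both sides are polynomials in [C]; [e1], [e2] and [e3]
    match the coefficients of [C * C], [C] and 1. Here [w] stands for [df], [dh] for the
    differential of the dressed surface, and [k] belongs to [lam]. *)
Lemma gauge_form_eq (w dh dchat N Nh chat s ds C k K : H) :
  C * K = K * C -> C * k = k * C -> K * k = k * K -> (1 + C * C) * k = -1 ->
  dchat + dh = w -> dh * Nh - dh * chat = w * N - chat * w ->
  dh * Nh * chat = dchat + chat * w * N ->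
  let u := (s * C - chat * s) * K in
  (ds * C - (dchat * s + chat * ds)) * K + dh * ((Nh * u + u * C) * k) =
  ((ds + w * ((N * s + s * C) * k)) * C - chat * (ds + w * ((N * s + s * C) * k))) * K.
Proof.
move=> CK Ck Kk CCk e1 e2 e3 u.
pose u0 := s * C - chat * s.
have -> : dh * ((Nh * u + u * C) * k) = dh * ((Nh * u0 + u0 * C) * k) * K.
  by rewrite /u -/u0 -[u0 * K * C]mulrA -CK !mulrA -mulrDl -!mulrA Kk !mulrA.
rewrite -mulrDl; congr (_ * K).
(* The relation [CCk] gives the term in [dchat * s] a right factor [k], which all other terms have
   already. *)
have sk : s = - (s * k + s * C * C * k).
  by rewrite -[in LHS](mulr1 s) -[1]opprK -CCk; quat_abel.
have dsk : dchat * s = - (dchat * s * k + dchat * s * C * C * k).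
  by rewrite {1}sk; quat_abel.
rewrite dsk /u0 !(mulrDl, mulrDr, mulrN, mulNr, mulrA) e3.
have -> : dh * Nh = w * N - chat * w + dh * chat by rewrite -e2 subrK.
rewrite -!(mulrA _ k C) -Ck -e1; quat_abel.
Qed.

End Gauge.

(** * Parallel sections and dressing *)

Section Beta.
Variables (R : realType) (M : riemannSurface R).
Local Notation H := (quat R).
Local Notation C := (complex R).
Implicit Types (f N al : M -> H) (lam : C).

Lemma betaE N al lam p : lam != 0 -> lam != 1 ->
  beta_of N lam al p =
  (N p * al p + al p * qC (cay lam)) * qC ((a_ lam - 1) / 2).
Proof. exact: beta_val. Qed.

Lemma smooth_beta N al lam : smoothH N -> smoothH al -> smoothH (beta_of N lam al).
Proof.
move=> sN sal; apply: smoothHM; first exact: smoothH_cst.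
apply: smoothHD; last by apply: smoothHM => //; exact: smoothH_cst.
by apply: smoothHM; [exact: smoothHM|exact: smoothH_cst].
Qed.

Lemma sqnormqM (x y : H) : sqnormq (x * y) = sqnormq x * sqnormq y.
Proof. by case: x y => a b c d [a' b' c' d']; rewrite /sqnormq /=; ring. Qed.

Lemma sqnormqN (x : H) : sqnormq (- x) = sqnormq x.
Proof. by rewrite /sqnormq /= !sqrrN. Qed.

Lemma sqnormqD_le (x y : H) : sqnormq (x + y) <= 2 * (sqnormq x + sqnormq y).
Proof.
case: x y => a b c d [a' b' c' d']; rewrite /sqnormq /=.
have := sqr_ge0 (a - a'); have := sqr_ge0 (b - b').
have := sqr_ge0 (c - c'); have := sqr_ge0 (d - d'); nra.
Qed.

Lemma sqnormq_sphere2 (x : H) : sphere2 x -> sqnormq x = 1.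
Proof.
case: x => a b c d [a0 /(congr1 (@qre R))]; rewrite /imq /= in a0.
by rewrite /sqnormq /= a0; lra.
Qed.

(** As [N] has norm 1, the equation bounds the norm of [d al] by a constant times the norms of [df]
    and [al]; by [zero_set_all] a single zero would make [al] trivial. *)
Lemma parallel_neq0 f N al lam : smoothH f -> (forall p, sphere2 (N p)) ->
  nontrivial_parallelN f N lam al -> forall p, al p != 0.
Proof.
move=> sf sN [[sal dal] [p1 alp1]] p0; apply: contra_neq alp1 => al0.
pose K := (2%:R * (sqnormq (qC (a_ lam - 1)) + sqnormq (qC (b_ lam)))) *
  sqnormq (2^-1 : H).
have K0 : 0 <= K.
  by apply: mulr_ge0 (sqnormq_ge0 _); apply: mulr_ge0 => //; apply: addr_ge0;
    exact: sqnormq_ge0.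
apply: (zero_set_all sal sf K0 _ al0) => i p v ip.
have /eqP := dal i p v ip; rewrite addr_eq0 => /eqP ->.
rewrite sqnormqN sqnormqM -mulrA mulrCA ler_wpM2l ?sqnormq_ge0//.
rewrite /beta_of sqnormqM /K.
set A := qC (a_ lam - 1); set B := qC (b_ lam).
have -> : 2 * (sqnormq A + sqnormq B) * sqnormq (2^-1 : H) * sqnormq (al p) =
  sqnormq (2^-1 : H) * (2 * (sqnormq (al p) * sqnormq A + sqnormq (al p) * sqnormq B)).
  by ring.
rewrite ler_wpM2l ?sqnormq_ge0//; apply: le_trans (sqnormqD_le _ _) _.
by rewrite !sqnormqM sqnormq_sphere2// mul1r.
Qed.

End Beta.

Lemma half_double (R : realType) (x : quat R) : 2^-1 * x + 2^-1 * x = x.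
Proof.
rewrite -mulrDl -qC_half -qCD (_ : 2^-1 + 2^-1 = 1); first by rewrite mul1r.
by field.
Qed.

(** * Identities for a CMC surface and its parallel surface *)

Section CMC.
Variables (R : realType) (M : riemannSurface R).
Local Notation H := (quat R).
Variables f N : M -> H.
Hypothesis cmc : cmc_surface f N.
Implicit Types (i : rs_idx M) (p : M) (v : R * R).

Lemma cmc_NN p : N p * N p = -1.
Proof. by have [_ [_ S2N] _ _ _] := cmc; have [] := S2N p. Qed.

Lemma cmc_star i p v : rs_dom i p -> dH f i p (Jplane v) = N p * dH f i p v.
Proof. by move=> ip; have [_ _ _ [sl _] _] := cmc; exact: sl. Qed.

Lemma cmc_anticomm i p v : rs_dom i p -> N p * dH f i p v = - (dH f i p v * N p).
Proof.
by move=> ip; rewrite -cmc_star//; have [_ _ _ [_ sr] _] := cmc; exact: sr.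
Qed.

Lemma cmc_double i p v : rs_dom i p ->
  dH f i p v + dH f i p v = - (dH N i p v - N p * dH N i p (Jplane v)).
Proof.
move=> ip; have [_ _ _ _ H1] := cmc.
by rewrite (H1 i p v ip) mulNr -opprD half_double.
Qed.

(** The mean curvature condition multiplied by [N] on the left. For [g = f + N] it reads
    [*dg = - N dg], so that [g] has Gauss map [- N]. *)
Lemma cmc_parallel_star i p v : rs_dom i p ->
  dH f i p (Jplane v) + dH N i p (Jplane v) = - (N p * (dH f i p v + dH N i p v)).
Proof.
move=> ip; have := congr1 (fun x => N p * x) (cmc_double v ip).
rewrite /= cmc_star// !(mulrDr, mulrN) opprD opprK !mulrA cmc_NN mulN1r => e.
have -> : dH N i p (Jplane v) = - (N p * dH N i p v) - (N p * dH f i p v + N p * dH f i p v).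
  by rewrite e; quat_abel.
quat_abel.
Qed.

End CMC.

(** * The dressed surface, its Gauss map and the gauge relation *)

Section Dressing.
Variables (R : realType) (M : riemannSurface R).
Local Notation H := (quat R).
Variables (f N al : M -> H) (mu : complex R).
Hypotheses (cmc : cmc_surface f N) (m0 : mu != 0) (m1 : mu != 1).
Hypotheses (hal : parallelN f N mu al) (al0 : forall p, al p != 0).
Implicit Types (i : rs_idx M) (p : M) (v : R * R).

Let c := qC (cay mu).
Let k := qC ((a_ mu - 1) / 2).
Let be := beta_of N mu al.

Definition conj_cay p := al p * qC (cay mu) * (al p)^-1.
Definition dressT p := al p * (beta_of N mu al p)^-1.
(** By [darboux_be] this is the [mu]-Darboux transform of the parallel surface. Its real part is
    constant where [al] has no zeros, but may be nonzero. *)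
Definition dressed p := f p - conj_cay p.

Local Notation chat := conj_cay.
Local Notation T := dressT.

Let sf : smoothH f. Proof. by case: cmc => -[]. Qed.
Let sN : smoothH N. Proof. by case: cmc => _ []. Qed.
Let sal : smoothH al. Proof. by case: hal. Qed.
Let NN := cmc_NN cmc.
Let ck : c * k = k * c. Proof. exact: qCC. Qed.
Let cck : (1 + c * c) * k = -1. Proof. exact: qC_cay_sqr. Qed.
Let beE p : be p = (N p * al p + al p * c) * k. Proof. exact: betaE. Qed.

Lemma smooth_be : smoothH be. Proof. exact: smooth_beta. Qed.

Lemma be_neq0 p : be p != 0.
Proof. exact: beta_neq0 (NN p) (al0 p) ck cck (beE p). Qed.

Lemma smooth_conj_cay : smoothH chat.
Proof.
apply: smoothHM; last exact: smoothHV.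
by apply: smoothHM => //; exact: smoothH_cst.
Qed.

Lemma smooth_dressT : smoothH T.
Proof. by apply: smoothHM => //; apply: smoothHV; [exact: be_neq0|exact: smooth_be]. Qed.

Lemma dal i p v : rs_dom i p -> dH al i p v = - (dH f i p v * be p).
Proof.
by move=> ip; apply/eqP; rewrite -addr_eq0; apply/eqP; have [_] := hal; exact.
Qed.

Lemma N_be p : N p * be p = al p + be p * c.
Proof. exact: N_beta (NN p) ck cck (beE p). Qed.

(** [N] anticommutes with [df], so by [N_be] the part [N d al] of [d(N al)] is [df (al + be c)],
    whose second term cancels against [d(al c)]. *)
Lemma dbe i p v : rs_dom i p ->
  dH be i p v = (dH f i p v + dH N i p v) * (al p * k).
Proof.
move=> ip.
have -> : be = fun p => (N p * al p + al p * c) * k by apply/funext => q; exact: beE.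
have [sc sk] : smoothH (fun _ : M => c) /\ smoothH (fun _ : M => k).
  by split; exact: smoothH_cst.
have s1 := smoothHM sN sal; have s2 := smoothHM sal sc.
rewrite (dHM _ (smoothHD s1 s2) sk ip) dH_cst mulr0 addr0 (dHD _ s1 s2 ip).
rewrite (dHM _ sN sal ip) (dHM _ sal sc ip) dH_cst mulr0 addr0 dal//.
set w := dH f i p v; set dn := dH N i p v.
have e : N p * - (w * be p) = w * (al p + be p * c).
  by rewrite mulrN mulrA cmc_anticomm// mulNr opprK -mulrA N_be.
rewrite e; quat_abel.
Qed.

Lemma be_gE p : beta_of (fun q => - N q) mu be p = - (al p * k).
Proof.
by rewrite betaE//; exact: beta_g (NN p) ck cck (beE p).
Qed.

(** The differential [dg (al k)] of [be] cancels against the connection term, because [be_gE] gives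
    [- al k]. *)
Lemma parallel_be : parallelN (fun p => f p + N p) (fun p => - N p) mu be.
Proof.
split=> [|i p v ip]; first exact: smooth_be.
by rewrite /dN be_gE dbe// (dHD _ sf sN ip) mulrN subrr.
Qed.

Lemma darboux_be p :
  darboux_map (fun p => f p + N p) be (beta_of (fun q => - N q) mu be) p = dressed p.
Proof.
rewrite /darboux_map be_gE (beta_div_beta_g (al0 p) cck (beE p) erefl).
by rewrite opprD addrA addrK.
Qed.

(** Differentiate [chat al = al c], insert [dal], and use [N be = al + be c] together with
    [T^-1 = be / al]. *)
Lemma d_conj_cay i p v : rs_dom i p ->
  dH chat i p v = dH f i p v + (N p + chat p) * dH f i p v * (T p)^-1.
Proof.
move=> ip; have ual : al p \is a GRing.unit by exact: al0.
have sc := smoothH_cst M c.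
have e : (fun p => chat p * al p) = fun p => al p * c.
  by apply/funext => q; rewrite /conj_cay divrK ?quat_unitE.
have := congr1 (fun F => dH F i p v) e.
rewrite /= (dHM _ smooth_conj_cay sal ip) (dHM _ sal sc ip) dH_cst mulr0 addr0.
move/(canRL (addrK _)) => {}e.
apply: (mulIr ual); rewrite e dal// (invT (NN p) (al0 p) ck cck (beE p) erefl).
set w := dH f i p v.
have -> : (w + (N p + chat p) * w * (be p / al p)) * al p =
    w * al p + (N p * w * be p + chat p * w * be p).
  by rewrite mulrDl -(mulrA (_ * w)) divrK// !mulrDl.
rewrite cmc_anticomm// !mulNr -(mulrA w (N p)) N_be; quat_abel.
Qed.

Lemma d_dressed i p v : rs_dom i p ->
  dH dressed i p v = - ((N p + chat p) * dH f i p v * (T p)^-1).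
Proof.
move=> ip; rewrite (dHB _ sf smooth_conj_cay ip) d_conj_cay//.
by rewrite opprD addrA subrr add0r.
Qed.

Definition dressed_normal p := T p * N p * (T p)^-1.
Local Notation Nh := dressed_normal.

Lemma dressed_normalE p : Nh p = T p + chat p.
Proof. exact: NhE (NN p) (al0 p) ck cck (beE p) erefl erefl. Qed.

Lemma T_neq0 p : T p != 0.
Proof. exact: T_unit (NN p) (al0 p) ck cck (beE p) erefl. Qed.

(** Differentiate [T be = al]. *)
Lemma d_dressT i p v : rs_dom i p ->
  dH T i p v = - dH f i p v -
    T p * (dH f i p v + dH N i p v) * (al p * k) * (be p)^-1.
Proof.
move=> ip; have ube : be p \is a GRing.unit by exact: be_neq0.
have e : (fun p => T p * be p) = al.
  apply/funext => q; exact: T_beta (NN q) (al0 q) ck cck (beE q) erefl.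
have := congr1 (fun F => dH F i p v) e.
rewrite /= (dHM _ smooth_dressT smooth_be ip) dbe// dal//.
move/(canRL (addrK _)) => {}e.
by apply: (mulIr ube); rewrite e mulrBl divrK// mulNr !mulrA.
Qed.

Lemma smooth_dressed_normal : smoothH Nh.
Proof.
apply: smoothHM; last exact: smoothHV T_neq0 smooth_dressT.
by apply: smoothHM => //; exact: smooth_dressT.
Qed.

Lemma smooth_dressed : smoothH dressed.
Proof. exact: smoothHB sf smooth_conj_cay. Qed.

(** In [dressed + Nh = f + T] the term [chat] has cancelled, and [df] cancels against the first term
    of [d_dressT]; only [dg] of the original parallel surface remains. *)
Lemma d_dressed_parallel i p v : rs_dom i p ->
  dH dressed i p v + dH Nh i p v =
  - (T p * (dH f i p v + dH N i p v) * (al p * k) * (be p)^-1).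
Proof.
move=> ip.
have -> : Nh = fun p => T p + chat p by apply/funext => q; exact: dressed_normalE.
rewrite (dHD _ smooth_dressT smooth_conj_cay ip) (dHB _ sf smooth_conj_cay ip).
rewrite d_dressT//; move: (T p * (dH f i p v + dH N i p v) * (al p * k) * (be p)^-1) => x.
quat_abel.
Qed.

Lemma dressed_star i p v : rs_dom i p ->
  dH dressed i p (Jplane v) = - (dH dressed i p v * Nh p).
Proof.
move=> ip; rewrite (d_dressed (Jplane v) ip) (d_dressed v ip) (cmc_star cmc _ ip) (cmc_anticomm cmc _ ip).
rewrite /dressed_normal; move: (T p) (T_neq0 p) => t t0.
by rewrite !(mulrN, mulNr, opprK) !mulrA mulrVK.
Qed.

(** From [*df = N df], with [Nh_Tg] moving [N] across [N + chat]. *)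
Lemma dressed_star_left i p v : rs_dom i p ->
  dH dressed i p (Jplane v) = Nh p * dH dressed i p v.
Proof.
move=> ip; rewrite (d_dressed (Jplane v) ip) (d_dressed v ip) (cmc_star cmc _ ip) mulrN.
have e := Nh_Tg (NN p) (al0 p) ck cck (beE p) (erefl (chat p)) (erefl (T p)).
rewrite -/(Nh p) in e; move: (Nh p) (T p) (chat p) e => nh t ch e.
by rewrite !mulrA e.
Qed.

Lemma Nh_NN p : Nh p * Nh p = -1.
Proof.
rewrite sqr_conj ?T_neq0// NN mulrN1 mulNr divrr//; exact: T_neq0.
Qed.

(** The relation [*dg = - N dg] passes through [d_dressed_parallel], since [T N = Nh T]. *)
Lemma dressed_parallel_star i p v : rs_dom i p ->
  dH dressed i p (Jplane v) + dH Nh i p (Jplane v) =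
  - (Nh p * (dH dressed i p v + dH Nh i p v)).
Proof.
move=> ip; apply: etrans (d_dressed_parallel (Jplane v) ip) _.
apply: etrans (congr1 (fun x => - (Nh p * x)) (esym (d_dressed_parallel v ip))).
have := cmc_parallel_star cmc v ip; rewrite /dressed_normal.
move: (dH f i p (Jplane v) + dH N i p (Jplane v)) (dH f i p v + dH N i p v).
move: (al p * k) (be p)^-1 (T p) (T_neq0 p).
move=> y z t t0 X Y ->.
by rewrite !mulrN !mulNr !mulrA mulrVK.
Qed.

(* The real part of [conj_cay] is the constant [Re (cay mu)]. *)
Definition dressed_im p := dressed p + Quat (complex.Re (cay mu)) 0 0 0.

Lemma d_dressed_im i p v : rs_dom i p -> dH dressed_im i p v = dH dressed i p v.
Proof.
by move=> ip; rewrite (dHD _ smooth_dressed (smoothH_cst _ _) ip) dH_cst addr0.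
Qed.

Lemma cmc_dressed : cmc_surface dressed_im Nh.
Proof.
have [[_ imf] [_ S2N] immf _ _] := cmc.
split.
- split=> [|p]; first exact: smoothHD smooth_dressed (smoothH_cst _ _).
  have f0 : qre (f p) = 0 := imf p.
  have c0 : qre (chat p) = complex.Re (cay mu) := qre_conj c (al0 p).
  rewrite /imq /= -[LHS]/(qre (f p) - qre (chat p) + complex.Re (cay mu)).
  by rewrite f0 c0 sub0r addNr.
- split=> [|p]; first exact: smooth_dressed_normal.
  exact: sphere2_conj (T_neq0 p) (S2N p).
- move=> i p v ip v0; rewrite d_dressed_im// d_dressed// oppr_eq0.
  apply: quat_mulf_neq0; last by rewrite -quat_unitE unitrV quat_unitE T_neq0.
  apply: quat_mulf_neq0; last exact: immf.
  exact: N_chat_unit (NN p) (al0 p) ck cck (beE p) erefl.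
- split=> i p v ip; rewrite /star /lmulf /rmulf !d_dressed_im//.
    exact: dressed_star_left.
  exact: dressed_star.
- move=> i p v ip; rewrite /star /lmulf d_dressed_im//.
  (* Mean curvature 1 is recovered by solving this relation for the star of [dH Nh] and multiplying
     by [Nh], with [Nh Nh = -1]. *)
  have e := dressed_parallel_star v ip; rewrite dressed_star_left// in e.
  have {}e : dH Nh i p (Jplane v) =
      - (Nh p * (dH dressed i p v + dH Nh i p v)) - Nh p * dH dressed i p v.
    by rewrite -e addrAC subrr add0r.
  have -> : Nh p * dH Nh i p (Jplane v) =
      dH Nh i p v + dH dressed i p v + dH dressed i p v.
    rewrite e; move: (Nh p) (Nh_NN p) (dH Nh i p v) => t tt ?.
    by rewrite mulrBr mulrN !mulrA tt !mulN1r !opprK; quat_abel.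
  by rewrite -[LHS]half_double mulNr -mulrN -mulrDr; congr (_ * _); quat_abel.
Qed.

Lemma dressed_gauge lam (s : M -> H) : lam != 0 -> lam != (conjc mu)^-1 -> smoothH s ->
  eq_form (dN dressed_im Nh lam (dressing_gauge mu lam al s))
          (dressing_gauge_form mu lam al (dN f N lam s)).
Proof.
move=> l0 lm ss i p v ip; have [l1|l1] := eqVneq lam 1.
  (* At [lam = 1] the gauge is the identity and both connection terms vanish. *)
  have -> : dressing_gauge mu lam al s = s by apply/funext => q; exact: gauge_id.
  rewrite /dressing_gauge_form gauge_id// /dN.
  have beta0 (N' : M -> H) : beta_of N' lam s p = 0.
    rewrite /beta_of l1 /a_ /b_ invr1 subrr mulr0 mul0r qC0 mulr0 addr0.
    by rewrite (_ : (1 + 1) / 2 - 1 = 0) ?qC0 ?mulr0//; field.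
  by rewrite !beta0 !mulr0.
have -> : dressing_gauge mu lam al s =
    fun q => (s q * qC (cay lam) - chat q * s q) * qC (cay lam - conjc (cay mu))^-1.
  by apply/funext => q; exact: gaugeE.
rewrite /dressing_gauge_form gaugeE// -/(chat p) /dN !betaE//.
set C := qC (cay lam); set K := qC _^-1; set l := qC ((a_ lam - 1) / 2).
have [sC sK] : smoothH (fun _ : M => C) /\ smoothH (fun _ : M => K).
  by split; exact: smoothH_cst.
have s1 := smoothHM ss sC; have s2 := smoothHM smooth_conj_cay ss.
rewrite (dHM _ (smoothHB s1 s2) sK ip) dH_cst mulr0 addr0 (dHB _ s1 s2 ip).
rewrite (dHM _ ss sC ip) (dHM _ smooth_conj_cay ss ip) dH_cst mulr0 addr0.
rewrite d_dressed_im//; apply: gauge_form_eq; try exact: qCC.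
- exact: qC_cay_sqr.
- by rewrite (dHB _ sf smooth_conj_cay ip) addrC subrK.
- rewrite -mulrBr dressed_normalE addrK d_dressed// mulNr.
  by rewrite mulrVK ?quat_unitE ?T_neq0// mulrDl opprD (cmc_anticomm cmc _ ip) opprK.
(* For the coefficient of 1: with [h = dressed], [dh Nh T] is computed from [*dh = - dh Nh]; then
   [T = Nh - chat] and [Nh Nh = -1] are substituted. *)
- have e : dH dressed i p v * Nh p * T p = - dH f i p v - chat p * dH f i p v * N p.
    rewrite -[_ * Nh p]opprK -(dressed_star v ip) d_dressed// opprK.
    rewrite mulrVK ?quat_unitE ?T_neq0// (cmc_star cmc _ ip) mulrDl !mulrA NN mulN1r.
    by rewrite -(mulrA (chat p)) (cmc_anticomm cmc _ ip) mulrN mulrA.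
  have TE : T p = Nh p - chat p by rewrite dressed_normalE addrK.
  have := dHB v sf smooth_conj_cay ip; rewrite -/dressed; rewrite TE in e.
  move: e (Nh_NN p); move: (dH dressed i p v) (dH chat i p v) (dH f i p v).
  move: (Nh p) (chat p) (N p) => nh ch y dd dc df + nn ddE.
  rewrite mulrBr -[dd * nh * nh]mulrA nn mulrN1 ddE => e.
  rewrite -[LHS](subKr (- (df - dc))) e; quat_abel.
Qed.

Lemma sfd_N_dressed : sfd_N f N mu (lineC al) dressed_im.
Proof.
exists al; split=> //; split; first exact: cmc_dressed.
by move=> lam l0 _ lm s ss; exact: dressed_gauge.
Qed.

(** The section [al'] behind [h] spans the same complex line as [al], so pointwise [al' = al z] with
    [z] complex, and [z] drops out of [T]. Thus [h] has Gauss map [Nh], which determines its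
    differential. *)
Lemma sfd_N_dH h : sfd_N f N mu (lineC al) h ->
  smoothH h /\ eq_form (dH dressed) (dH h).
Proof.
move=> [al' [[_ al'0] lE [cmch _]]].
have TE : (fun p => al' p / beta_of N mu al' p) = T.
  apply/funext => p; have : lineC al' p (al' p).
    by exists 1 => //; rewrite qC1 mulr1.
  rewrite -lE => -[z _ zE].
  have z0 : qC z != 0 by apply: contra_neq (al'0 p) => z0; rewrite -zE z0 mulr0.
  have -> : beta_of N mu al' p = be p * qC z.
    have [zc zk] : qC z * c = c * qC z /\ qC z * k = k * qC z by split; exact: qCC.
    rewrite betaE// beE -zE -/c -/k; move: (qC z) (c) (k) zc zk => u y x uy ux.
    by rewrite -(mulrA (al p)) uy !mulrA -mulrDl -!mulrA ux.
  rewrite -zE invrM ?quat_unitE//; last exact: be_neq0.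
  by rewrite mulrA mulrK.
have hE := congr1 (fun t : M -> H => fun p => t p * N p * (t p)^-1) TE.
have {}cmch : cmc_surface h Nh by rewrite /dressed_normal -hE.
have [[sh _] _ _ _ Hh] := cmch; have [_ _ _ _ Hd] := cmc_dressed.
by split=> // i p v ip; rewrite Hh// -d_dressed_im// Hd.
Qed.

End Dressing.

(** * Dressing and Bianchi permutability in the quaternionic plane *)

Section Columns.
Variable R : realType.
Local Notation H := (quat R).
Implicit Types (a b c d x y : H) (u w : 'cV[H]_2).

Lemma col2E u : u = col2 (u 0 0) (u 1 0).
Proof.
apply/matrixP => i j; rewrite !mxE ord1.
by case: i => [[|[|//]] hi]; congr (u _ _); apply: val_inj.
Qed.

Lemma col2P u w : u 0 0 = w 0 0 -> u 1 0 = w 1 0 -> u = w.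
Proof. by move=> e0 e1; rewrite [u]col2E [w]col2E e0 e1. Qed.

Lemma col2_mx a b : (col2 a b 0 0 = a) * (col2 a b 1 0 = b).
Proof. by rewrite !mxE. Qed.

Lemma rscale_col2 a b x : rscale (col2 a b) x = col2 (a * x) (b * x).
Proof. by apply: col2P; rewrite !mxE. Qed.

Lemma rscaleA u x y : rscale (rscale u x) y = rscale u (x * y).
Proof. by apply: col2P; rewrite !mxE mulrA. Qed.

Lemma addcol2 a b c d : col2 a b + col2 c d = col2 (a + c) (b + d).
Proof. by apply: col2P; rewrite !mxE. Qed.

Lemma subcol2 a b c d : col2 a b - col2 c d = col2 (a - c) (b - d).
Proof. by apply: col2P; rewrite !mxE. Qed.

Lemma mat2M a b c d a' b' c' d' : mat2 a b c d *m mat2 a' b' c' d' =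
  mat2 (a * a' + b * c') (a * b' + b * d') (c * a' + d * c') (c * b' + d * d').
Proof.
apply/matrixP => i j; rewrite !mxE big_ord_recl big_ord1 !mxE /=.
by case: i => [[|[|//]] hi]; case: j => [[|[|//]] hj].
Qed.

Lemma mat2_1 : mat2 1 0 0 1 = 1%:M :> 'M[H]_2.
Proof.
apply/matrixP => i j; rewrite !mxE.
by case: i => [[|[|//]] hi]; case: j => [[|[|//]] hj].
Qed.

Lemma mat2_col2 a b c d x y : mat2 a b c d *m col2 x y =
  col2 (a * x + b * y) (c * x + d * y).
Proof. by apply: col2P; rewrite !mxE big_ord_recl big_ord1 !mxE. Qed.

Lemma row_mx_col2 a b c d : row_mx (col2 a c) (col2 b d) = mat2 a b c d :> 'M[H]_2.
Proof.
apply/matrixP => i j; rewrite !mxE; case: splitP => j' /= jE; rewrite ord1 in jE;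
  rewrite !mxE.
  by rewrite (_ : j = 0)//; apply: val_inj.
by rewrite (_ : j = 1)//; apply: val_inj.
Qed.

Lemma mulmx_rscale (A : 'M[H]_2) u x : A *m rscale u x = rscale (A *m u) x.
Proof.
apply/matrixP => i j; rewrite !mxE mulr_suml.
by apply: eq_bigr => k _; rewrite !mxE mulrA.
Qed.

Lemma lineH_rscale u x : x != 0 -> lineH (rscale u x) = lineH u.
Proof.
rewrite -quat_unitE => ux; apply/seteqP; split=> _ [y _ <-].
  by exists (x * y) => //; rewrite rscaleA.
by exists (x^-1 * y) => //; rewrite rscaleA mulVKr.
Qed.

Lemma lineH_image (A : 'M[H]_2) u : [set A *m w | w in lineH u] = lineH (A *m u).
Proof.
apply/seteqP; split=> [_ [_ [x _ <-] <-]|_ [x _ <-]].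
  by exists x => //; rewrite mulmx_rscale.
by exists (rscale u x); [exists x|rewrite mulmx_rscale].
Qed.

Lemma lineH_psi_inj x y : lineH (psi x) = lineH (psi y) -> x = y.
Proof.
move=> e; have : lineH (psi x) (psi x) by exists 1 => //; rewrite rscale_col2 !mulr1.
rewrite e => -[z _]; rewrite rscale_col2 mul1r => E.
have := congr1 (fun u : 'cV[H]_2 => u 1 0) E; rewrite /psi !col2_mx => z1.
by have := congr1 (fun u : 'cV[H]_2 => u 0 0) E; rewrite /psi !col2_mx z1 mulr1.
Qed.

Lemma mat2_scalarC (z11 z12 z21 z22 w : complex R) :
  mat2 (qC z11) (qC z12) (qC z21) (qC z22) *m mat2 (qC w) 0 0 (qC w) =
  mat2 (qC w) 0 0 (qC w) *m mat2 (qC z11) (qC z12) (qC z21) (qC z22).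
Proof. by rewrite !mat2M !(mulr0, mul0r, addr0, add0r) ![qC w * _]qCC. Qed.

(** Independence of the basis: [P *m A] is a second basis with inverse [Q'], and [D] commutes with
    the change of basis [A]. *)
Lemma conj_mx_eq m (P A D Q Q' : 'M[H]_m) : Q *m P = 1%:M -> P *m A *m Q' = 1%:M ->
  A *m D = D *m A -> P *m A *m D *m Q' = P *m D *m Q.
Proof.
move=> QP PAQ AD; rewrite -(mulmxA P A) AD !mulmxA -[RHS]mulmx1 -PAQ !mulmxA.
by rewrite -(mulmxA _ Q P) QP mulmx1.
Qed.

End Columns.

Section Sections.
Variables (R : realType) (M : riemannSurface R).
Local Notation H := (quat R).
Implicit Types (f N al be : M -> H) (mu : complex R).

Lemma sectionE f al be p : section f al be p = col2 (al p + f p * be p) (be p).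
Proof.
by rewrite /section /evec /psi !rscale_col2 addcol2 !(mul1r, mul0r, add0r).
Qed.

Lemma smooth_section f al be : smoothH f -> smoothH al -> smoothH be ->
  smoothH2 (section f al be).
Proof.
move=> sf sal sbe k.
rewrite (_ : (fun p => section f al be p k 0) =
    if k == 0 then fun p => al p + f p * be p else be).
  by case: ifP => _ //; apply: smoothHD => //; exact: smoothHM.
by apply/funext => p; rewrite sectionE mxE; case: ifP.
Qed.

(** The two terms [df be] in [d(al + f be)] cancel, which leaves [f d be]; so the differential takes
    values in [L]. *)
Lemma dH2_section f al be i p v : smoothH f -> smoothH al -> smoothH be ->
  dH al i p v = - (dH f i p v * be p) -> rs_dom i p ->
  dH2 (section f al be) i p v = rscale (psi (f p)) (dH be i p v).
Proof.
move=> sf sal sbe dal ip; rewrite /psi rscale_col2 mul1r.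
have e0 : (fun q => section f al be q 0 0) = fun q => al q + f q * be q.
  by apply/funext => q; rewrite sectionE col2_mx.
have e1 : (fun q => section f al be q 1 0) = be.
  by apply/funext => q; rewrite sectionE col2_mx.
apply: col2P; rewrite !mxE ?e0 ?e1//=.
rewrite (dHD _ sal (smoothHM sf sbe) ip) (dHM _ sf sbe ip) dal.
by rewrite addrA addNr add0r.
Qed.

Lemma parallelS_evec f N mu (n : H) : parallelS f N mu (fun=> rscale (evec R) n).
Proof.
split=> [k|i p v ip]; first exact: smoothH_cst.
have e1 : rscale (evec R) n 1 0 = 0 by rewrite !mxE mul0r.
rewrite /dS /beta_of e1 !(mulr0, mul0r, addr0) /psi rscale_col2 !mulr0.
by apply: col2P; rewrite !mxE dH_cst addr0.
Qed.

End Sections.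

(** * The quaternionic lines of the dressing and of the 2-fold transform *)

Section TwoFold.
Variables (R : realType) (M : riemannSurface R).
Local Notation H := (quat R).
Variables (f N al : M -> H) (mu : complex R).
Hypotheses (cmc : cmc_surface f N) (m0 : mu != 0) (m1 : mu != 1).
Hypotheses (hal : parallelN f N mu al) (al0 : forall p, al p != 0).
Implicit Types (i : rs_idx M) (p : M) (v : R * R).

Let c := qC (cay mu).
Let k := qC ((a_ mu - 1) / 2).
Let be := beta_of N mu al.
Let sf : smoothH f. Proof. by case: cmc => -[]. Qed.
Let sal : smoothH al. Proof. by case: hal. Qed.
Let sbe : smoothH be. Proof. exact: smooth_be cmc hal. Qed.
Let be0 p : be p != 0. Proof. exact: (be_neq0 cmc m0 m1 al0). Qed.
Let dfd := dressed f al mu.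
Let phi := section f al be.

Lemma dH2_phi i p v : rs_dom i p -> dH2 phi i p v = rscale (psi (f p)) (dH be i p v).
Proof. by move=> ip; apply: dH2_section => //; exact: dal. Qed.

(** Both terms of [dS] are multiples of [psi], and the condition reduces to [parallel_be]. *)
Lemma parallelS_phi : parallelS f N mu phi.
Proof.
split=> [|i p v ip]; first exact: smooth_section sf sal sbe.
have [_ /(_ i p v ip)] := parallel_be cmc m0 m1 hal.
have e1 : (fun q => phi q 1 0) = be.
  by apply/funext => q; rewrite /phi sectionE col2_mx.
rewrite /dS /dN e1 -/be dH2_phi// => e; rewrite /psi !rscale_col2 addcol2 !mul1r.
by rewrite e -mulrDr e mulr0; apply: col2P; rewrite !mxE.
Qed.

Section Line.
Variable n : H.
Hypothesis n0 : n != 0.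
Let en : M -> 'cV[H]_2 := fun=> rscale (evec R) n.

Let Phi p : 'M[H]_2 := row_mx (en p) (phi p).
Let Psi p : 'M[H]_2 :=
  mat2 n^-1 (- (n^-1 * (al p + f p * be p) * (be p)^-1)) 0 (be p)^-1.

Lemma PhiE p : Phi p = mat2 n (al p + f p * be p) 0 (be p).
Proof. by rewrite /Phi /phi sectionE /en rscale_col2 mul1r mul0r row_mx_col2. Qed.

Lemma PhiK p : Phi p *m Psi p = 1%:M /\ Psi p *m Phi p = 1%:M.
Proof.
have ube : be p \is a GRing.unit by exact: be0.
rewrite PhiE /Psi !mat2M !(mul0r, mulr0, addr0, add0r) -mat2_1.
have un : n \is a GRing.unit by [].
move: (be p) (al p + f p * be p) ube => b x ub.
rewrite mulrN mulNr [n * (_ / b)]mulrA [n * (_ * x)]mulrA !divrr// !mulVr// mul1r.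
by rewrite divrK// addrN addNr.
Qed.

(** [S psi = - psi N], and the second entry of the other summand is [be c be^-1 = N - T]. In the sum
    [N] cancels and [- T] factors out on the right. *)
Lemma sfd_matrix_psi p :
  (2^-1 *: (Smap f N p + Phi p *m mat2 c 0 0 c *m Psi p)) *m psi (f p) =
  rscale (psi (dfd p + n * c * n^-1)) (- (2^-1 * dressT N al mu p)).
Proof.
have ube : be p \is a GRing.unit by exact: be0.
have un : n \is a GRing.unit by [].
set t := dressT N al mu p.
have tE : t * be p = al p by exact: (divrK ube).
have cE : conj_cay al mu p * al p = al p * c by rewrite /conj_cay divrK// quat_unitE.
have NbE : be p * c * (be p)^-1 = N p - t.
  have e := N_be al cmc m0 m1 p; rewrite -/be -/c in e.
  by apply: (mulIr ube); rewrite divrK// mulrBl tE e addrAC subrr add0r.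
have SE : Smap f N p *m psi (f p) = col2 (- (f p * N p)) (- N p).
  rewrite /Smap /psi -!mulmxA !mat2_col2 !(mul1r, mulr1, mul0r, add0r, addr0) subrr.
  by rewrite !(mulr0, add0r, mulrN).
have BE : Phi p *m mat2 c 0 0 c *m Psi p *m psi (f p) =
    col2 ((conj_cay al mu p - n * c * n^-1) * t + f p * (N p - t)) (N p - t).
  have tE' : al p / be p = t by [].
  rewrite PhiE /Psi /psi; clearbody t.
  move: (be p) (al p) (f p) (N p) (conj_cay al mu p) ube tE' cE NbE {SE tE}.
  move=> b a x y z ub tE cE NbE.
  rewrite -!mulmxA !mat2_col2 !(mul1r, mulr1, mul0r, add0r, addr0).
  have -> : n^-1 * x - n^-1 * (a + x * b) / b = - (n^-1 * t).
    by rewrite -mulrA mulrDl mulrK// tE mulrDr opprD addrCA subrr addr0.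
  have -> : (a + x * b) * (c * b^-1) = z * t + x * (y - t).
    by rewrite mulrDl -NbE -tE !mulrA cE.
  congr col2; last by rewrite mulrA.
  by rewrite !mulrN !mulrA mulrBl addrCA addrA.
rewrite -scalemxAl mulmxDl SE BE addcol2 /psi rscale_col2 mul1r.
apply: col2P; rewrite mxE !col2_mx; last by rewrite addrA addNr add0r mulrN.
rewrite /dfd /dressed; clearbody t; move: (conj_cay al mu p) (n * c * n^-1) => y z.
rewrite mulrN mulrA -halfC -[2^-1 * _ * t]mulrA -[RHS]mulrN; congr (_ * _); quat_abel.
Qed.

(** Pointwise, two bases of [W] differ by a complex matrix, which commutes with the diagonal matrix
    of [c]; so the line depends on [W] only. *)
Lemma sfd_S_line (W : M -> set 'cV[H]_2) fh : W = spanC en phi ->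
  sfd_S f N mu W fh -> fh = (fun p => dfd p + n * c * n^-1).
Proof.
move=> -> [phi1 [phi2 [Psi' [_ WE PhiK' lE]]]]; apply/funext => p.
have [PP' P'P] := PhiK' p; have [PP P1P] := PhiK p.
have in1 : spanC phi1 phi2 p (phi1 p).
  by exists 1, 0; apply: col2P; rewrite !mxE qC1 qC0 mulr1 mulr0 addr0.
have in2 : spanC phi1 phi2 p (phi2 p).
  by exists 0, 1; apply: col2P; rewrite !mxE qC1 qC0 mulr1 mulr0 add0r.
rewrite -WE in in1 in2; case: in1 => z11 [z21 e1]; case: in2 => z12 [z22 e2].
pose A := mat2 (qC z11) (qC z12) (qC z21) (qC z22).
have PA : row_mx (phi1 p) (phi2 p) = Phi p *m A.
  rewrite e1 e2 PhiE /A mat2M /phi sectionE /en !rscale_col2 !addcol2 row_mx_col2.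
  by rewrite !mul0r !add0r mul1r.
apply: lineH_psi_inj; rewrite lE (lineH_image (2^-1 *: _)).
have -> : row_mx (phi1 p) (phi2 p) *m mat2 (qC (b_ mu / (a_ mu - 1))) 0 0
    (qC (b_ mu / (a_ mu - 1))) *m Psi' p = Phi p *m mat2 c 0 0 c *m Psi p.
  by rewrite PA; apply: conj_mx_eq P1P _ (mat2_scalarC _ _ _ _ _); rewrite -PA.
rewrite sfd_matrix_psi lineH_rscale// oppr_eq0.
apply: quat_mulf_neq0; last exact: (T_neq0 cmc m0 m1 al0).
by rewrite -qC_half qC_eq0 invr_eq0 pnatr_eq0.
Qed.

Lemma sfd_S_dressed : sfd_S f N mu (spanC en phi) (fun p => dfd p + n * c * n^-1).
Proof.
exists en, phi, Psi; split=> //.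
- by split; [exact: parallelS_evec|exact: parallelS_phi].
- exact: PhiK.
- move=> p; rewrite (lineH_image (2^-1 *: _)) -/(cay mu) -/c sfd_matrix_psi.
  rewrite lineH_rscale// oppr_eq0.
  apply: quat_mulf_neq0; last exact: (T_neq0 cmc m0 m1 al0).
  by rewrite -qC_half qC_eq0 invr_eq0 pnatr_eq0.
Qed.

End Line.

Section Bianchi.
Variable al1 : M -> H.
Hypotheses (hal1 : parallelN f N (-1) al1) (al10 : forall p, al1 p != 0).
Hypothesis mN1 : mu != -1.

Let be1 := beta_of N (-1) al1.
Let n10 : (-1 : complex R) != 0. Proof. by rewrite oppr_eq0 oner_eq0. Qed.
Let n11 : (-1 : complex R) != 1.
Proof. by rewrite -subr_eq0 -opprD oppr_eq0 -(natrD _ 1 1) pnatr_eq0. Qed.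

(** At the parameter -1, [cay] vanishes and [(a - 1) / 2 = -1]. Hence [al1 / be1 = N] where [al1] is
    nonzero, and this Darboux transform is [g]. *)
Lemma be1E p : be1 p = - (N p * al1 p).
Proof.
rewrite /be1 betaE// cayE// addrN mulr0 mul0r qC0 mulr0 addr0.
have -> : (a_ (-1) - 1) / 2 = -1 :> complex R.
  by rewrite /a_ invrN invr1; field.
by rewrite qCN qC1 mulrN1.
Qed.

Lemma dbe1 i p v : rs_dom i p ->
  dH be1 i p v = - ((dH f i p v + dH N i p v) * al1 p).
Proof.
move=> ip; rewrite (dbe cmc n10 n11 hal1)//.
have -> : (a_ (-1) - 1) / 2 = -1 :> complex R.
  by rewrite /a_ invrN invr1; field.
by rewrite qCN qC1 !mulrN !mulr1.
Qed.

(** Here [mu != -1] enters: for [cay mu = 0] the vector spanning the line of the 2-fold transform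
    would vanish. *)
Lemma cay_neq0 : cay mu != 0.
Proof.
rewrite cayE// !mulf_neq0//.
- by rewrite eq_complex /= oner_eq0 andbF.
- by rewrite addrC addr_eq0.
- by rewrite invr_eq0 subr_eq0 eq_sym.
Qed.

Lemma bianchi_dressed :
  bianchi f al be al1 be1 (darboux_map f al be) (fun p => f p + N p) dfd.
Proof.
have sbe1 : smoothH be1 by exact: smooth_be cmc hal1.
have sal1 : smoothH al1 by case: hal1.
have cck : (1 + c * c) * k = -1 by exact: qC_cay_sqr.
have alk p : al p * k \is a GRing.unit by exact: alk_unit (al0 p) cck.
have sk := smoothH_cst M k.
(* The sections of [al] and [al1] have differentials [psi dg (al k)] and [- psi dg al1], which gives
   this [chi]. *)
exists (fun p => (- (al p * k))^-1 * al1 p); split.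
- split; [exact: smooth_section|exact: smooth_section|].
  apply: smoothHM => //; apply: smoothHV => [p|].
    by rewrite oppr_eq0; exact: alk.
  by apply: smoothHN; exact: smoothHM.
- move=> i p v ip; split; first by rewrite dH2_phi//; exists (dH be i p v).
  rewrite dH2_section//; first by exists (dH be1 i p v).
  exact: (dal hal1 v ip).
- move=> p; split=> //; first exact: (be_neq0 cmc n10 n11 al10).
  have NN := cmc_NN cmc p; have u1 : al1 p \is a GRing.unit by exact: al10.
  congr (_ + _); have u : be1 p \is a GRing.unit by exact: (be_neq0 cmc n10 n11 al10).
  by apply: (mulIr u); rewrite divrK// be1E mulrN mulrA NN mulN1r opprK.
- move=> i p v ip; rewrite dH2_phi// dH2_section//; last exact: (dal hal1 v ip).
  rewrite rscaleA dbe1// (dbe cmc m0 m1 hal)//; congr (rscale _ _).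
  by rewrite -mulrA invrN mulNr [_ * - _ in RHS]mulrN mulVKr// mulrN.
- move=> p; rewrite !sectionE rscale_col2 subcol2.
  have ual : al p \is a GRing.unit by exact: al0.
  (* The products of [be] and [al] with [chi] are expressed by [chat], using
     [be beta_g^-1 = - (N + chat)] and [- k^-1 = 1 + c c]. *)
  have e1 : be p * ((- (al p * k))^-1 * al1 p) = - (N p + conj_cay al mu p) * al1 p.
    have bE : be p = (N p * al p + al p * c) * k by exact: betaE.
    by rewrite mulrA (beta_div_beta_g (al0 p) cck bE (erefl (conj_cay al mu p))).
  have e2 : al p * ((- (al p * k))^-1 * al1 p) =
      al1 p + conj_cay al mu p * conj_cay al mu p * al1 p.
    have kE : - k^-1 = 1 + c * c.
      have uk := k_unit cck; apply: (mulIr uk).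
      by rewrite cck mulNr mulVr.
    have -> : (- (al p * k))^-1 = (1 + c * c) * (al p)^-1.
      by rewrite invrN invrM ?(k_unit cck)// -mulNr kE.
    rewrite /conj_cay -/c sqr_conj//; move: (al p) ual (al1 p) (c) => a ua a1 x.
    by rewrite !mulrA mulrDr !mulrA mulr1 !mulrDl divrr// mul1r.
  have -> : col2 (al1 p + f p * be1 p - (al p + f p * be p) * ((- (al p * k))^-1 * al1 p))
      (be1 p - be p * ((- (al p * k))^-1 * al1 p)) =
      rscale (psi (dfd p)) (conj_cay al mu p * al1 p).
    rewrite /psi rscale_col2 mul1r mulrDl -(mulrA (f p)) e1 e2 be1E /dfd /dressed.
    move: (conj_cay al mu p) (al1 p) (f p) (N p) => z a y x.
    by congr col2; quat_abel.
  rewrite lineH_rscale//; apply: quat_mulf_neq0; last exact: al10.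
  rewrite /conj_cay; apply: quat_mulf_neq0; last by rewrite -quat_unitE unitrV.
  by apply: quat_mulf_neq0 => //; rewrite qC_eq0 cay_neq0.
Qed.

End Bianchi.
End TwoFold.

(** All surfaces are compared with [dressed f al mu]: the dressing by [W] adds [n c n^-1], the
    dressing by [E] adds some constant, and the Darboux and Bianchi transforms are [dressed f al mu]
    itself. *)
Theorem theorem5p6 (R : realType) (M Mt : riemannSurface R) (pi : Mt -> M)
    (hpi : universal_cover pi)
    (f0 N0 : M -> quat R) (hf : cmc_surface f0 N0) (hns : ~ round_sphere f0)
    (mu : complex R) (hmu0 : mu != 0) (hmu1 : mu != 1) (hmuN1 : mu != - 1)
    (al : Mt -> quat R)
    (hal : nontrivial_parallelN (f0 \o pi) (N0 \o pi) mu al)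
    (n : quat R) (hn : n != 0) :
  let f : Mt -> quat R := f0 \o pi in
  let N : Mt -> quat R := N0 \o pi in
  let g : Mt -> quat R := fun p => f p + N p in
  let mN : Mt -> quat R := fun p => - N p in
  let be := beta_of N mu al in
  let en : Mt -> 'cV[quat R]_2 := fun=> rscale (evec R) n in
  let phi := section f al be in
  let W := spanC en phi in
  let E := lineC al in
  [/\ parallelS f N mu en, parallelS f N mu phi,
      exists fh, sfd_S f N mu W fh &
      forall fh, sfd_S f N mu W fh ->
        [/\ exists h, sfd_N f N mu E h,
            forall h, sfd_N f N mu E h -> eq_up_to_translation fh h &
            exists2 fd, eq_up_to_translation fh fd &
              mu_darboux g mN mu be fd /\
              forall al0, nontrivial_parallelN f N (- 1) al0 ->
                bianchi f al be al0 (beta_of N (- 1) al0)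
                  (darboux_map f al be) g fd]].
Proof.
move=> f N g mN be en phi W E.
have cmc : cmc_surface f N := cmc_surface_comp hpi.1 hf.
have [[sf _] [_ S2N] _ _ _] := cmc.
have al0 := parallel_neq0 sf S2N hal.
have [hpar _] := hal.
(* By [be_gE] this is the denominator of the Darboux transform of [g]. *)
have k0 p : - (al p * qC ((a_ mu - 1) / 2)) != 0.
  rewrite oppr_eq0; apply: quat_mulf_neq0 => //.
  by rewrite qC_eq0 mulf_neq0 ?a_sub1_neq0// invr_eq0 pnatr_eq0.
split.
- exact: parallelS_evec.
- exact: parallelS_phi.
- by eexists; exact: (sfd_S_dressed cmc hmu0 hmu1 hpar al0 hn).
move=> fh /(sfd_S_line cmc hmu0 hmu1 al0 hn (erefl W)) ->.
have sd := smooth_dressed cmc hpar al0.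
set c := n * _ / n; split.
- by eexists; exact: (sfd_N_dressed cmc hmu0 hmu1 hpar al0).
- move=> h /(sfd_N_dH cmc hmu0 hmu1 hpar al0)[sh dh].
  apply: dH_eq_cst => //; first exact: smoothHD sd (smoothH_cst _ _).
  by move=> i p v ip; rewrite (dHD _ sd (smoothH_cst _ _) ip) dH_cst addr0 dh.
- exists (dressed f al mu); first by exists c.
  split; first split.
  + split; first exact: parallel_be.
    have [p _] := rs_nonempty Mt; exists p; exact: (be_neq0 cmc hmu0 hmu1 al0).
  + move=> p; rewrite (darboux_be cmc hmu0 hmu1 al0); split=> //.
    by rewrite (be_gE al cmc hmu0 hmu1).
  + move=> al1 hal1; apply: bianchi_dressed => //; first by have [] := hal1.
    exact: parallel_neq0 sf S2N hal1.
Qed.
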